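(* Let $\delta\in(0,2)$ and let $K$ be a covariance function whose spectral density $\hat K$ satisfies the following: there are constants $p\in\mathbb{N}$ and $\beta\in(1/2,\infty)$ such that (1) $C'_K:=\lim_{\omega\to\infty}\hat K(\omega)|\omega|^{2p}$ exists and lies in $(0,\infty)$; (2) $\limsup_{\omega\to\infty}\left|\left(\frac{\hat K(\omega)|\omega|^{2p}}{C'_K}-1\right)\omega^\beta\right|<\infty$. Consider the shift-in-mean testing problem described in the context, in which $\mathrm{cov}(\boldsymbol X)=[K((r-s)/n)]_{r,s=1}^n$. There are positive scalars $\bar C_K$ and $n_0=n_0(K)$ such that if $n\ge n_0$ and $$|b|\le\bar C_K\,n^{-p+1/2}\sqrt{\log\left(\frac1{\delta(2-\delta)}\right)},$$ then for any test $T$, $\varphi_n(T)\ge\delta$.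
   Context: Observations: $\boldsymbol X=(X_1,\dots,X_n)^\top$, $X_k=G(k/n)$, where $G$ is a Gaussian process on $[0,1]$ with $G-\mathbb{E}G$ stationary with covariance function $K$; $\hat K(\omega)=\int_{\mathbb{R}}K(t)e^{-j\omega t}dt$ is the spectral density. Testing problem: fix $\alpha\in(0,1/2)$ and let $\mathcal{C}_{n,\alpha}=\{t\in\{1,\dots,n\}:t\wedge(n-t)>\alpha n\}$. For $t\in\mathcal{C}_{n,\alpha}$ let $\zeta_t\in\mathbb{R}^n$ have $\zeta_t(k)=-1$ for $k\le t$ and $+1$ for $k>t$. The null hypothesis is $\mathbb{H}_0:\mathbb{E}\boldsymbol X=0$; the alternative with change point $t$ and jump $b\ne0$ is $\mathbb{H}_{1,t}:\mathbb{E}\boldsymbol X=\frac b2\zeta_t$ (same covariance). A test is a measurable function $T$ of $\boldsymbol X$ with values in $\{0,1\}$, and $\varphi_n(T)=\mathbb{P}(T=1\mid\mathbb{H}_0)+\max_{t\in\mathcal{C}_{n,\alpha}}\mathbb{P}(T=0\mid\mathbb{H}_{1,t})$, where under $\mathbb{H}_{1,t}$ the jump size is $b$.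
   Formalization: The range δ∈(0,2) is restricted to δ∈(0,1]: for δ∈(1,2) the claim is false, since nonzero b are admissible and the constant test T=0 has φ_n(T)=1<δ. K is assumed integrable and C_{n,α} nonempty, so that the spectral density and the maximum make sense. *)

(* Defs.v *)
From HB Require Import structures.
From mathcomp Require Export all_boot all_order all_algebra.
From mathcomp Require Export all_classical all_reals all_analysis.

Set Implicit Arguments.
Unset Strict Implicit.
Unset Printing Implicit Defensive.

Import Order.TTheory GRing.Theory Num.Theory.
Import numFieldNormedType.Exports.

Local Open Scope classical_set_scope.
Local Open Scope ring_scope.

Section covariance_functions.
Context {R : realType}.
Implicit Types K : R -> R.

Definition covariance_function K : Prop :=
  (forall t, K (- t) = K t) /\
  (forall (k : nat) (x u : 'I_k -> R),
     0 <= \sum_(i < k) \sum_(j < k) u i * u j * K (x i - x j)).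

(* Real part of \int K(t) e^{-j w t} dt; the imaginary part
   - \int K(t) sin(w t) dt vanishes when K is even. *)
Definition spectral_density K (w : R) : R :=
  Rintegral lebesgue_measure setT (fun t => K t * cos (w * t)).

End covariance_functions.

Section gaussian_processes.
Context {R : realType} {d : measure_display} {Om : measurableType d}.

(* The library's [normal_prob m 0] is not the point mass at [m]. *)
Definition gaussian_law (m s : R) (A : set (measurableTypeR R)) : \bar R :=
  if s == 0 then \d_m A else normal_prob m s A.

Definition gaussian_process (P : probability Om R)
    (G : R -> {mfun Om >-> measurableTypeR R}) : Prop :=
  forall (k : nat) (x u : 'I_k -> R), (forall i, 0 <= x i <= 1) ->
    exists m s : R, forall A : set (measurableTypeR R), measurable A ->
      P ((fun w => \sum_(i < k) u i * G (x i) w) @^-1` A) = gaussian_law m s A.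

(* For Gaussian G, stationarity of G - E G is stationarity of the covariance. *)
Definition has_covariance (P : probability Om R)
    (G : R -> {mfun Om >-> measurableTypeR R}) (K : R -> R) : Prop :=
  forall s t : R, 0 <= s <= 1 -> 0 <= t <= 1 ->
    covariance P (G s) (G t) = (K (s - t))%:E.

(* Index k : 'I_n stands for the sample of rank k.+1. *)
Definition observation (n : nat) (G : R -> {mfun Om >-> measurableTypeR R})
    (w : Om) : n.-tuple (measurableTypeR R) :=
  [tuple G (k.+1%:R / n%:R) w | k < n].

Definition has_mean (n : nat) (P : probability Om R)
    (G : R -> {mfun Om >-> measurableTypeR R}) (mu : 'I_n -> R) : Prop :=
  forall k : 'I_n, 'E_P[fun w => tnth (observation n G w) k]%E = (mu k)%:E.

End gaussian_processes.

Section shift_in_mean.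
Context {R : realType}.

Definition change_points (alpha : R) (n : nat) : pred nat :=
  [pred t | (0 < t <= n)%N && (alpha * n%:R < (minn t (n - t))%:R)].

Definition zeta (n t : nat) (k : 'I_n) : R := if (k.+1 <= t)%N then -1 else 1.

Context {d : measure_display} {Om : measurableType d}.

Definition null_hypothesis (n : nat) (K : R -> R)
    (G : R -> {mfun Om >-> measurableTypeR R}) (P : probability Om R) : Prop :=
  [/\ gaussian_process P G, has_covariance P G K
    & has_mean P G (fun _ : 'I_n => 0)].

Definition alternative_hypothesis (n : nat) (K : R -> R) (b : R) (t : nat)
    (G : R -> {mfun Om >-> measurableTypeR R}) (P : probability Om R) : Prop :=
  [/\ gaussian_process P G, has_covariance P G K
    & has_mean P G (fun k : 'I_n => b / 2 * zeta t k)].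

(* The default value 0 of the maximum is only reached when there is no
   admissible change point. *)
Definition test_error (n : nat) (alpha : R)
    (G : R -> {mfun Om >-> measurableTypeR R})
    (P0 : probability Om R) (P1 : nat -> probability Om R)
    (T : {mfun n.-tuple (measurableTypeR R) >-> bool}) : R :=
  fine (P0 [set w | T (observation n G w) = true]) +
  \big[Num.max/0]_(1 <= t < n.+1 | t \in change_points alpha n)
     fine (P1 t [set w | T (observation n G w) = false]).

End shift_in_mean.

(* Main.v *)
Require Import Defs.
From mathcomp Require Import ring lra zify.
From mathcomp Require Import measurable_realfun.
From mathcomp.real_closed Require Import complex.

Set Implicit Arguments.
Unset Strict Implicit.
Unset Printing Implicit Defensive.

Import Order.TTheory GRing.Theory Num.Theory.
Import numFieldNormedType.Exports.

Local Open Scope classical_set_scope.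
Local Open Scope ring_scope.

(** Write S for the covariance matrix [K((i - j) / n)], zeta for the step vector
    of one admissible change point, and mu = (b / 2) zeta for the mean under the
    corresponding alternative.

    Reduction to two hypotheses.  The maximum over change points is at least
    the error at this single one.  If S u = mu, then the law of the sample under
    the alternative has density L = exp (u . X - D / 2) with respect to its law
    under the null, where D = u . mu = u . S u.  The Hellinger affinity is
    E [sqrt L] = exp (- D / 8), and it bounds the total error m of any test from
    below through m (2 - m) >= exp (- D / 4) (affinity_bound).  So m >= delta
    as soon as D <= 4 log (1 / (delta (2 - delta))).

    The deterministic inequality.  Everything rests on the existence of a
    constant C, depending only on K, such that for large n and all vectors u
      (u . zeta)^2 <= C n^(2p - 1) (u . S u)         (step_detection_bound).
    It makes zeta orthogonal to the kernel of S, so that S u = mu is solvable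
    (solve_from_quadratic_bound) even when S is singular, and then it gives
    D^2 <= (b / 2)^2 C n^(2p - 1) D.  The assumed bound on b finishes the proof.

    Why the inequality holds.  Let U be the trigonometric sum with coefficients
    u.  Formally u . S u is the integral of the spectral density times |U|^2,
    and the density is about w^(-2p) at high frequencies.  No inversion formula
    is needed: y |-> sum u_i u_j K(x_i - x_j + y) is bounded by its value at 0
    because K is positive semidefinite (cov_form_max), and integrating it
    against Fejer kernels shows that u . S u controls the integral of the
    density times |U|^2 over [H, pi n] (spectral_lower_bound).  The low
    frequencies, where the limit says nothing about the density, are avoided: a
    combination of four triangles vanishes there and is nonnegative elsewhere.

    Passing from the coefficients of U to their p-fold sums over windows of
    length n divides U by (1 - e^(iw/n))^p up to a bounded factor, which absorbs
    the weight w^(-2p) (energy_window_sum_le).  The new sum V has its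
    coefficients at times in [0, p + 1], hence V cannot concentrate on the
    frequencies below H: on that time interval the constant 1 is within 1/2 of
    a combination of cosines of high frequencies only (high_frequency_approx_1),
    so the low part of V is recovered from its high part (energy_uncertainty).
    Parseval then bounds the sum of the squares of the coefficients of V.  The
    first n of them determine the partial sums of u, because a window which
    starts before time 0 sees only a partial sum (partial_sum_sqr_le); and
    u . zeta is a combination of two partial sums (step_sqr_le).

    Identification of the density.  Exponential moments are computed from the
    definition of a Gaussian process (gaussian_sample_mgf), so L dP0 and dP1
    have the same finite exponential moments.  The functions g for which
    multiplying by g(X_i) preserves this equality are closed under sums,
    products and dominated limits.  They contain the exponentials, hence
    successively the identity, sines, signs, indicators of half-lines and of
    Borel sets; products of indicators give boxes, and boxes generate the
    sigma-algebra (same_integral_tuple). *)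

(** * Lebesgue integrals on the line *)
Section real_integrals.
Context {R : realType}.
Local Notation mu := (@lebesgue_measure R).
Implicit Types (f g F : R -> R) (a b c : R).

Lemma continuous_integrable_itv f a b :
  continuous f -> mu.-integrable `[a, b] (EFin \o f).
Proof.
move=> cf; apply: continuous_compact_integrable; first exact: segment_compact.
exact: continuous_subspaceT.
Qed.

Lemma Rintegral_FTC2 f F a b : a <= b -> continuous f ->
  (forall x, is_derive x (1 : R) F (f x)) ->
  \int[mu]_(x in `[a, b]) f x = F b - F a.
Proof.
rewrite le_eqVlt => /predU1P[->|ab] cf dF.
  by rewrite set_itv1 Rintegral_set1 subrr.
have cF : continuous F.
  move=> x; apply: differentiable_continuous; apply/derivable1_diffP.
  by case: (dF x).
rewrite /Rintegral (@continuous_FTC2 _ f F a b) //.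
- exact: continuous_subspaceT.
- split.
  + by move=> x _; case: (dF x).
  + exact/cvg_at_right_filter/cF.
  + exact/cvg_at_left_filter/cF.
- by move=> x _; rewrite derive1E derive_val.
Qed.

Lemma lebesgue_measure_translate c (A : set R) : measurable A ->
  pushforward mu (fun x : measurableTypeR R => x + c : measurableTypeR R) A = mu A.
Proof.
move=> mA; apply/esym.
have mD : measurable_fun setT (fun x : measurableTypeR R => x + c : measurableTypeR R).
  exact: measurable_funD.
apply: (lebesgue_measure_unique (mu := [the measure _ _ of pushforward mu (fun x : measurableTypeR R => x + c : measurableTypeR R)])) => //= _ [[a b]] _ <-.
rewrite /pushforward.
have -> : (fun x => x + c) @^-1` `]a, b]%classic = `]a - c, b - c]%classic.
  by apply/seteqP; split=> x /=; rewrite !in_itv/= ltrBlDr lerBrDr.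
by rewrite !lebesgue_measure_itv/= !lte_fin ltrD2r -!EFinB; congr (if _ then _%:E else _); ring.
Qed.

Lemma integral_translate c (f : R -> \bar R) (D : set R) : measurable D ->
  measurable_fun setT f -> mu.-integrable ((fun x => x + c) @^-1` D) (f \o (fun x => x + c)) ->
  (\int[mu]_(x in (fun x => x + c)%R @^-1` D) f (x + c)%R = \int[mu]_(x in D) f x)%E.
Proof.
move=> mD mf fi.
have mc : measurable_fun setT (fun x : measurableTypeR R => x + c : measurableTypeR R).
  exact: measurable_funD.
rewrite -(integral_pushforward mc mf fi mD).
by apply: eq_measure_integral => //= A mA AD; rewrite -(lebesgue_measure_translate c).
Qed.

End real_integrals.

Section interval_integrals.
Context {R : realType}.
Local Notation mu := (@lebesgue_measure R).
Implicit Types (f g F : R -> R) (a b c : R).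

Lemma Rintegral_itv_translate f a b c : continuous f ->
  \int[mu]_(x in `[a, b]) f (x + c) = \int[mu]_(x in `[a + c, b + c]) f x.
Proof.
move=> cf; rewrite /Rintegral; congr fine.
have E : (fun x => x + c) @^-1` `[a + c, b + c]%classic = `[a, b]%classic.
  by apply/seteqP; split=> x /=; rewrite !in_itv/= !lerD2r.
rewrite -[in RHS](integral_translate (c := c) (f := EFin \o f)) //=; first by rewrite E.
  by apply/measurable_EFinP; apply: continuous_measurable_fun.
rewrite E; apply: (continuous_integrable_itv (f := fun x => f (x + c))).
move=> x; apply: (@continuous_comp _ _ _ (fun x => x + c) f); last exact: cf.
by apply: cvgD; [exact: cvg_id | exact: cvg_cst].
Qed.

Lemma Rintegral_itv_opp f a b : continuous f ->
  \int[mu]_(x in `[a, b]) f (- x) = \int[mu]_(x in `[- b, - a]) f x.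
Proof.
move=> cf; rewrite /Rintegral; congr fine.
have E : (-%R : measurableTypeR R -> measurableTypeR R) @^-1` `[- b, - a]%classic = `[a, b]%classic.
  by apply/seteqP; split=> x /=; rewrite !in_itv/= !lerN2 andbC.
have := @integral_pushforward _ _ (measurableTypeR R) (measurableTypeR R) R (-%R : measurableTypeR R -> measurableTypeR R) (@oppr_measurable _ _) mu `[- b, - a]%classic (EFin \o f).
rewrite E => <- //.
  apply: eq_measure_integral => //= A mA _; exact: lebesgue_measureN.
  by apply/measurable_EFinP; apply: continuous_measurable_fun.
apply: (continuous_integrable_itv (f := fun x => f (- x))).
by move=> x; apply: (@continuous_comp _ _ _ -%R f); [exact: opp_continuous|exact: cf].
Qed.

Lemma continuous_le_Rintegral f g a b : continuous f -> continuous g ->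
  (forall x, a <= x <= b -> f x <= g x) ->
  \int[mu]_(x in `[a, b]) f x <= \int[mu]_(x in `[a, b]) g x.
Proof.
move=> cf cg fg; apply: le_Rintegral => //; try exact: continuous_integrable_itv.
Qed.

Lemma Rintegral_itv_cat f a b c : continuous f -> a <= b <= c ->
  \int[mu]_(x in `[a, c]) f x =
  \int[mu]_(x in `[a, b]) f x + \int[mu]_(x in `[b, c]) f x.
Proof.
move=> cf /andP[ab bc].
have ci a1 b1 := @continuous_integrable_itv R f a1 b1 cf.
have := @Rintegral_itvB R f (BLeft a) (BRight c) b (ci a c).
rewrite !bnd_simp => /(_ ab bc) /eqP; rewrite subr_eq => /eqP ->.
rewrite addrC; congr +%R; apply: Rintegral_itv_obnd_cbnd.
by apply: integrableS (ci b c) => //; apply: subset_itvr; rewrite bnd_simp.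
Qed.

Lemma Rintegral_itv_subset f a b c d : continuous f ->
  (forall x, 0 <= f x) -> c <= a -> b <= d ->
  \int[mu]_(x in `[a, b]) f x <= \int[mu]_(x in `[c, d]) f x.
Proof.
move=> cf f0 ca bd; have [ab|/ltW ba] := leP a b; last first.
  rewrite [leLHS](_ : _ = 0); first by apply: Rintegral_ge0 => x _; exact: f0.
  move: ba; rewrite le_eqVlt => /predU1P[->|ba].
    by rewrite set_itv1 Rintegral_set1.
  by rewrite set_itv_ge ?Rintegral_set0// bnd_simp -ltNge.
rewrite (Rintegral_itv_cat (a := c) (b := a) (c := d)) //; last by rewrite ca (le_trans ab).
rewrite (Rintegral_itv_cat (a := a) (b := b) (c := d)) //; last by rewrite ab.
rewrite addrCA lerDl addr_ge0 //; apply: Rintegral_ge0 => x _; exact: f0.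
Qed.

End interval_integrals.

Section finite_sums.
Context {R : realType} {d : measure_display} {T : measurableType d}.

Lemma Rintegral_sum (P : {measure set T -> \bar R}) (D : set T) (m : nat)
    (f : 'I_m -> T -> R) :
  measurable D -> (forall i, P.-integrable D (EFin \o f i)) ->
  P.-integrable D (EFin \o (fun x => \sum_(i < m) f i x)) /\
  \int[P]_(x in D) (\sum_(i < m) f i x) = \sum_(i < m) \int[P]_(x in D) f i x.
Proof.
move=> mD; elim: m f => [|m IH] f fi.
  split; last first.
    rewrite big_ord0 (@eq_Rintegral _ _ _ P _ (cst 0)) => [|z _]; last by rewrite big_ord0.
    by rewrite /Rintegral integral0.
  have := integrable0 P D; congr (P.-integrable _ _).
  by apply/funext => z /=; rewrite big_ord0.
have [i1 i2] := IH _ (fun i => fi (lift ord0 i)).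
have E1 : (fun z => \sum_(i < m.+1) f i z) = (fun z => f ord0 z + \sum_(i < m) f (lift ord0 i) z).
  by apply/funext => z; rewrite big_ord_recl.
rewrite E1; split; first exact: (integrableD mD (fi ord0) i1).
by rewrite RintegralD // big_ord_recl i2.
Qed.

End finite_sums.

Section translation.
Context {R : realType}.
Local Notation mu := (@lebesgue_measure R).

Lemma integrable_translate (f : R -> R) (c : R) : mu.-integrable setT (EFin \o f) ->
  mu.-integrable setT (EFin \o (fun x => f (x + c))).
Proof.
move=> /integrableP[mf fi].
have mc : measurable_fun setT (fun x : measurableTypeR R => x + c : measurableTypeR R).
  exact: measurable_funD.
apply/integrableP; split; first exact: (measurableT_comp mf mc).
move: fi; congr (_ < _)%E.
have := @ge0_integral_pushforward _ _ (measurableTypeR R) (measurableTypeR R) R _ mc mu setT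
  (fun x => `|(f x)%:E|%E) measurableT.
move=> H; rewrite [RHS](_ : _ = (\int[mu]_x ((fun x => `|(f x)%:E|) \o (fun x => x + c)%R) x)%E)//.
rewrite -[RHS]H //.
- by apply: eq_measure_integral => //= A mA _; rewrite -(lebesgue_measure_translate c).
- exact: measurableT_comp.
Qed.

Lemma Rintegral_translate (f : R -> R) (c : R) : mu.-integrable setT (EFin \o f) ->
  \int[mu]_x f (x + c) = \int[mu]_x f x.
Proof.
move=> fi; rewrite /Rintegral; congr fine.
apply: (integral_translate (D := setT) (f := EFin \o f)) => //.
  by case/integrableP: fi.
exact: integrable_translate.
Qed.

End translation.

(** * Approximation of 1 by high frequencies *)
Section high_frequencies.
Context {R : realType}.
Local Open Scope complex_scope.

Lemma cos_near_1 : exists2 x0 : R, 0 < x0 & forall x, `|x| <= x0 -> 7 / 8 <= cos x.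
Proof.
have := @continuous_cos R 0; rewrite /continuous_at cos0 => /cvgrPdist_le /(_ (1/8)).
have e0 : (0 : R) < 1 / 8 by lra.
move=> /(_ e0) /nbhs_ballP [e /= e1 H]; exists (e / 2); first by rewrite divr_gt0.
move=> x xe; have /H : ball 0 e x.
  by rewrite -ball_normE /= sub0r normrN (le_lt_trans xe) // ltr_pdivrMr // ltr_pMr // ltr1n.
move=> /ler_normlP [_]; lra.
Qed.

Let cis (x : R) : R[i] := cos x +i* sin x.

Let cisX x k : cis x ^+ k = cis (k%:R * x).
Proof.
elim: k => [|k IH]; first by rewrite expr0 mul0r /cis cos0 sin0.
rewrite exprSr IH /cis -natr1 mulrDl mul1r cosD sinD.
by simpc; congr (_ +i* _); rewrite addrC.
Qed.

(** Induction on N from 1 - (1 - a)^(N+1) = (1 - (1 - a)^N) + (1 - a)^N a,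
    with |1 - a| <= 2. *)
Lemma one_sub_expr_le (a : R[i]) N : `|a| <= 1 ->
  `|1 - (1 - a) ^+ N| <= 2 ^+ N * `|a|.
Proof.
move=> a1; elim: N => [|N IH]; first by rewrite !expr0 subrr normr0 mul1r.
have -> : 1 - (1 - a) ^+ N.+1 = (1 - (1 - a) ^+ N) + (1 - a) ^+ N * a.
  by rewrite exprSr; ring.
rewrite (le_trans (ler_normD _ _)) // exprS mulr2n !mulrDl !mul1r lerD //.
rewrite normrM normrX ler_wpM2r // lerXn2r ?nnegrE //.
by rewrite (le_trans (ler_normB _ _)) // normr1 lerD2l.
Qed.

(** The polynomial (1 - (1 - z)^(N+1))^N is divisible by z^N, because
    1 - (1 - z)^(N+1) is divisible by z; and at z = e^(ix) with |1 - z| <= 1/2 it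
    differs from 1 by at most 2^N |1 - z|^(N+1) <= 1/2.  Its real part is the
    combination of cosines.  The radius x0 does not depend on N, which is what
    allows arbitrarily high frequencies. *)
Lemma high_frequency_approx_1 : exists2 x0 : R, 0 < x0 &
  forall N : nat, exists (M : nat) (c : nat -> R), forall x, `|x| <= x0 ->
    `|1 - \sum_(k < M) c k * cos ((N + k)%:R * x)| <= 2^-1.
Proof.
have [x0 x0_gt0 Hx0] := cos_near_1; exists x0 => // N.
pose m := N.+1.
pose q : {poly R} := \sum_(i < m) (1 - 'X) ^+ i.
pose Q := q ^+ N.
exists (size Q), (fun k => Q`_k) => x xx0.
pose z := cis x.
pose ev (p : {poly R}) := (map_poly (real_complex R) p).[z].
have ev_sum p : ev p = \sum_(k < size p) (p`_k)%:C * z ^+ k.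
  rewrite /ev horner_coef size_map_poly; apply: eq_bigr => k _.
  by rewrite coef_map.
have E : 1 - (1 - (1 - z) ^+ m) ^+ N = 1 - z ^+ N * ev Q.
  congr (1 - _).
  have -> : 1 - (1 - z) ^+ m = z * ev q.
    rewrite -[1 - _ ^+ _]opprB subrX1 -mulNr opprB opprB addrC subrK; congr (_ * _).
    rewrite /ev /q rmorph_sum horner_sum; apply: eq_bigr => i _.
    by rewrite rmorphXn rmorphB rmorph1 /= map_polyX horner_exp hornerD hornerN hornerX hornerC.
  by rewrite exprMn /ev /Q rmorphXn horner_exp.
(* |1 - z|^2 = 2 - 2 cos x, so cos x >= 7/8 gives |1 - z| <= 1/2 *)
have a12 : `|1 - z| <= 2^-1.
  rewrite -(@ler_pXn2r _ 2) ?nnegrE //.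
  have -> : `|1 - z| ^+ 2 = (2 - 2 * cos x)%:C.
    rewrite /z /cis /= sqr_normc; simpc.
    have := cos2Dsin2 x; move: (cos x) (sin x) => c s cs.
    congr (_ +i* _); last by ring.
    transitivity (1 - 2 * c + (c ^+ 2 + s ^+ 2)); first by ring.
    by rewrite cs; ring.
  have -> : (2^-1 : R[i]) ^+ 2 = (2^-1 ^+ 2)%:C by rewrite rmorphXn /= fmorphV rmorph_nat.
  rewrite lecR; have := Hx0 _ xx0; lra.
have P12 : `|1 - z ^+ N * ev Q| <= 2^-1.
  rewrite -E (le_trans (one_sub_expr_le _ _)) //.
    rewrite normrX exprn_ile1 //; apply: le_trans a12 _; rewrite invf_le1 ?ler1n//.
  rewrite normrX /m exprS mulrCA -exprMn -[leRHS]mulr1 ler_pM ?exprn_ge0 ?mulr_ge0 //.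
  by rewrite exprn_ile1 ?mulr_ge0 // -ler_pdivlMl // mulr1.
have := le_trans (normc_ge_Re _) P12.
have -> : (2^-1 : R[i]) = (2^-1 : R)%:C by rewrite fmorphV rmorph_nat.
rewrite lecR; apply: le_trans; rewrite le_eqVlt; apply/orP; left; apply/eqP.
congr `|_|; rewrite ev_sum mulr_sumr raddfB /=; congr (1 - _); rewrite raddf_sum.
apply: eq_bigr => k _; rewrite mulrCA -exprD /z cisX /cis; simpc => /=.
by [].
Qed.
End high_frequencies.

(** * Energy of a trigonometric sum *)
Section energy.
Context {R : realType}.
Local Notation mu := (@lebesgue_measure R).
Implicit Types (v : {poly R}) (x y : R).

(** A finite sequence of coefficients is stored as a polynomial, so that shifts
    and differences of sequences become products.  The energy is the squared
    modulus of the value of the polynomial at e^(ix). *)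
Definition cos_sum v x := \sum_(i < size v) v`_i * cos (i%:R * x).
Definition sin_sum v x := \sum_(i < size v) v`_i * sin (i%:R * x).
Definition energy v x := cos_sum v x ^+ 2 + sin_sum v x ^+ 2.

Lemma coef_sum_widen (f : nat -> R) v m : (size v <= m)%N ->
  \sum_(i < size v) v`_i * f i = \sum_(i < m) v`_i * f i.
Proof.
move=> vm; rewrite -(big_mkord xpredT (fun i => v`_i * f i)).
rewrite -(big_mkord xpredT (fun i => v`_i * f i)) [RHS](big_cat_nat (n := size v)) //=.
rewrite [X in _ = _ + X]big_nat_cond [X in _ = _ + X]big1 ?addr0 // => i.
by rewrite andbT => /andP[vi _]; rewrite nth_default ?mul0r.
Qed.

Lemma cos_sumE m v x : (size v <= m)%N ->
  cos_sum v x = \sum_(i < m) v`_i * cos (i%:R * x).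
Proof. exact: (coef_sum_widen (fun i => cos (i%:R * x))). Qed.

Lemma sin_sumE m v x : (size v <= m)%N ->
  sin_sum v x = \sum_(i < m) v`_i * sin (i%:R * x).
Proof. exact: (coef_sum_widen (fun i => sin (i%:R * x))). Qed.

Lemma energy_ge0 v x : 0 <= energy v x.
Proof. by rewrite addr_ge0 ?sqr_ge0. Qed.

Lemma energyN v x : energy v (- x) = energy v x.
Proof.
rewrite /energy /cos_sum /sin_sum; congr (_ + _).
  by congr (_ ^+ 2); apply: eq_bigr => i _; rewrite mulrN cosN.
rewrite -sqrrN -sumrN; congr (_ ^+ 2); apply: eq_bigr => i _.
by rewrite mulrN sinN mulrN opprK.
Qed.

Lemma continuous_scale (c : R) : continuous (fun x => c * x).
Proof. by move=> x; apply: cvgM; [exact: cvg_cst|exact: cvg_id]. Qed.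

Lemma continuous_cos_scale c : continuous (fun x : R => cos (c * x)).
Proof.
move=> x; apply: (@continuous_comp _ _ _ (fun x => c * x) cos).
  exact: continuous_scale.
exact: continuous_cos.
Qed.

Lemma continuous_sin_scale c : continuous (fun x : R => sin (c * x)).
Proof.
move=> x; apply: (@continuous_comp _ _ _ (fun x => c * x) sin).
  exact: continuous_scale.
exact: continuous_sin.
Qed.

Lemma is_derive_scale c x : is_derive x (1 : R) (fun y => c * y) c.
Proof.
have -> : (fun y => c * y) = c \*: (@id R) by [].
by apply: is_derive_eq; rewrite /GRing.scale /= mulr1.
Qed.

Lemma is_derive_sin_scale c x :
  is_derive x (1 : R) (fun y => sin (c * y)) (cos (c * x) * c).
Proof.
exact: (@is_derive1_comp _ (@sin R) (fun y => c * y) _ _ _ _ (is_derive_scale c x)).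
Qed.

Lemma is_derive_cos_scale c x :
  is_derive x (1 : R) (fun y => cos (c * y)) (- sin (c * x) * c).
Proof.
exact: (@is_derive1_comp _ (@cos R) (fun y => c * y) _ _ _ _ (is_derive_scale c x)).
Qed.

Lemma continuous_sum (n : nat) (f : 'I_n -> R -> R) :
  (forall i, continuous (f i)) -> continuous (fun x => \sum_(i < n) f i x).
Proof.
elim: n f => [|n IH] f cf.
  by under eq_fun do rewrite big_ord0; exact: cst_continuous.
under eq_fun do rewrite big_ord_recl.
move=> x; apply: cvgD; first exact: cf.
by apply: (IH (fun i => f (lift ord0 i))) => i; exact: cf.
Qed.

Lemma continuous_energy v : continuous (energy v).
Proof.
have H (g : R -> R -> R) : (forall c, continuous (g c)) ->
    continuous (fun x => (\sum_(i < size v) v`_i * g i%:R x) ^+ 2).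
  move=> cg x; apply: (@continuous_comp _ _ _ _ (fun y : R => y ^+ 2)).
    apply: (@continuous_sum _ (fun i x => v`_i * g i%:R x)) => i y.
    by apply: cvgM; [exact: cvg_cst|exact: cg].
  exact: exprn_continuous.
move=> x; apply: cvgD; [apply: (H (fun c x => cos (c * x)))|
  apply: (H (fun c x => sin (c * x)))] => c.
  exact: continuous_cos_scale.
exact: continuous_sin_scale.
Qed.

Lemma continuous_energy_scale v c d : continuous (fun x => energy v (c * x + d)).
Proof.
move=> x; apply: (@continuous_comp _ _ _ (fun x => c * x + d) (energy v)).
  by apply: cvgD; [exact: continuous_scale|exact: cvg_cst].
exact: continuous_energy.
Qed.

Lemma energyE v x m : (size v <= m)%N -> energy v x =
  \sum_(i < m) \sum_(j < m) v`_i * v`_j * cos ((i%:R - j%:R) * x).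
Proof.
move=> vm; rewrite /energy (cos_sumE _ vm) (sin_sumE _ vm) !expr2 !mulr_suml.
rewrite -big_split /=; apply: eq_bigr => i _; rewrite !mulr_sumr -big_split /=.
apply: eq_bigr => j _; rewrite mulrBl cosB; ring.
Qed.

(** The value at e^(ix) is multiplied by 1 - e^(ikx), whose squared modulus is
    2 - 2 cos (kx). *)
Lemma energy_mul_1subXn v k x :
  energy ((1 - 'X^k) * v) x = (2 - 2 * cos (k%:R * x)) * energy v x.
Proof.
set m := (k + size v)%N.
have sXv : (size ('X^k * v)%R <= m)%N.
  by apply: leq_trans (size_polyMleq _ _) _; rewrite size_polyXn addSn.
have sv : (size v <= m)%N by rewrite leq_addl.
have sw : (size ((1 - 'X^k) * v)%R <= m)%N.
  rewrite mulrBl mul1r; apply: leq_trans (size_polyD _ _) _.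
  by rewrite geq_max sv size_polyN.
have shift (f : nat -> R) : \sum_(i < m) ('X^k * v)`_i * f i =
    \sum_(i < size v) v`_i * f (k + i)%N.
  rewrite big_split_ord /= big1 ?add0r => [|i _].
    by apply: eq_bigr => i _; rewrite coefXnM ltnNge leq_addr /= addKn.
  by rewrite coefXnM ltn_ord mul0r.
have E (f : nat -> R) : \sum_(i < m) ((1 - 'X^k) * v)`_i * f i =
    \sum_(i < size v) v`_i * f i - \sum_(i < size v) v`_i * f (k + i)%N.
  rewrite (coef_sum_widen f sv) -shift -sumrB; apply: eq_bigr => i _.
  by rewrite mulrBl mul1r coefB mulrBl.
have -> : energy ((1 - 'X^k) * v) x =
    (cos_sum v x - (cos (k%:R * x) * cos_sum v x - sin (k%:R * x) * sin_sum v x)) ^+ 2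
  + (sin_sum v x - (sin (k%:R * x) * cos_sum v x + cos (k%:R * x) * sin_sum v x)) ^+ 2.
  rewrite {1}/energy (cos_sumE _ sw) (sin_sumE _ sw).
  rewrite (E (fun i => cos (i%:R * x))) (E (fun i => sin (i%:R * x))).
  congr ((_ - _) ^+ 2 + (_ - _) ^+ 2).
    rewrite /cos_sum /sin_sum !mulr_sumr -sumrB; apply: eq_bigr => i _.
    rewrite natrD mulrDl cosD; ring.
  rewrite /cos_sum /sin_sum !mulr_sumr -big_split; apply: eq_bigr => i _ /=.
  rewrite natrD mulrDl sinD; ring.
rewrite /energy; have := cos2Dsin2 (k%:R * x).
move: (cos _) (sin _) (cos_sum _ _) (sin_sum _ _) => c s C S cs.
transitivity ((1 - 2 * c + (c ^+ 2 + s ^+ 2)) * (C ^+ 2 + S ^+ 2)); first ring.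
rewrite cs; ring.
Qed.

(** The cosines of the frequencies k / n go through a whole number of periods on
    the interval, which is why their mean vanishes. *)
Lemma integral_cos_period (k : int) (n : nat) : (0 < n)%N -> k != 0 ->
  \int[mu]_(x in `[- (pi * n%:R), pi * n%:R]) cos (k%:~R * (x / n%:R)) = 0.
Proof.
move=> n0 k0; set b := pi * n%:R.
have n0' : n%:R != 0 :> R by rewrite pnatr_eq0 -lt0n.
have k0' : k%:~R != 0 :> R by rewrite intr_eq0.
pose c : R := k%:~R / n%:R.
have c0 : c != 0 by rewrite mulf_neq0 ?invr_eq0.
have -> : (fun x : R => cos (k%:~R * (x / n%:R))) = fun x => cos (c * x).
  by apply/funext => x; rewrite /c mulrAC -mulrA.
transitivity (sin (c * b) / c - sin (c * - b) / c); last first.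
  have -> : c * b = k%:~R * pi by rewrite /c /b; field.
  have -> : c * - b = - (k%:~R * pi) by rewrite /c /b; field.
  suff H (j : nat) : sin (j%:R * pi) = 0 :> R.
    rewrite sinN; suff -> : sin (k%:~R * pi) = 0 :> R by rewrite !(oppr0, mul0r, addr0).
    case: k {k0 k0' c c0} => j; first exact: H.
    by rewrite NegzE mulrNz mulNr sinN H oppr0.
  elim: j => [|j IH]; first by rewrite mul0r sin0.
  by rewrite -natr1 mulrDl mul1r sinDpi IH oppr0.
apply: (@Rintegral_FTC2 _ _ (fun x => sin (c * x) / c)).
- by rewrite ge0_cp // /b mulr_ge0 // pi_ge0.
- exact: continuous_cos_scale.
- move=> x.
  have -> : (fun x => sin (c * x) / c) = c^-1 \*: (fun x => sin (c * x)).
    by apply/funext => y; rewrite /= mulrC.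
  apply: (is_derive_eq (@is_deriveZ _ _ _ _ c^-1 _ _ _ (is_derive_sin_scale c x))).
  by rewrite /GRing.scale /= mulrC -mulrA divff // mulr1.
Qed.

Lemma Rintegral_sum_itv (m : nat) (f : 'I_m -> R -> R) a b :
  (forall i, continuous (f i)) ->
  \int[mu]_(x in `[a, b]) (\sum_(i < m) f i x) =
  \sum_(i < m) \int[mu]_(x in `[a, b]) f i x.
Proof.
move=> cf; apply: (Rintegral_sum _ _).2 => // i; exact: continuous_integrable_itv.
Qed.

Lemma Rintegral_itvZl (f : R -> R) c a b : continuous f ->
  \int[mu]_(x in `[a, b]) (c * f x) = c * \int[mu]_(x in `[a, b]) f x.
Proof. by move=> cf; rewrite RintegralZl //; exact: continuous_integrable_itv. Qed.

Lemma energy_scaled_continuous v (n : nat) : continuous (fun x => energy v (x / n%:R)).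
Proof.
have -> : (fun x => energy v (x / n%:R)) = (fun x => energy v (n%:R^-1 * x + 0)).
  by apply/funext => x; rewrite addr0 mulrC.
exact: continuous_energy_scale.
Qed.

(** Parseval's identity: in the expansion of the energy as a double sum of
    cosines, only the diagonal terms survive integration. *)
Lemma energy_parseval v (n m : nat) : (0 < n)%N -> (size v <= m)%N ->
  \int[mu]_(x in `[- (pi * n%:R), pi * n%:R]) energy v (x / n%:R) =
  2 * pi * n%:R * \sum_(i < m) v`_i ^+ 2.
Proof.
move=> n0 vm; set b := pi * n%:R.
have b0 : 0 <= b by rewrite mulr_ge0 ?pi_ge0.
have cc (k : R) : continuous (fun x : R => cos (k * (x / n%:R))).
  have -> : (fun x : R => cos (k * (x / n%:R))) = (fun x => cos (k / n%:R * x)).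
    by apply/funext => x; rewrite mulrAC -mulrA.
  exact: continuous_cos_scale.
have ccm (d k : R) : continuous (fun x : R => d * cos (k * (x / n%:R))).
  by move=> x; apply: cvgM; [exact: cvg_cst|exact: cc].
under eq_Rintegral do rewrite (energyE _ vm).
rewrite Rintegral_sum_itv; last first.
  by move=> i; apply: continuous_sum => j; exact: ccm.
rewrite mulr_sumr; apply: eq_bigr => i _.
rewrite Rintegral_sum_itv => [|j]; last exact: ccm.
rewrite (bigD1 i) //= big1 => [|j ji]; last first.
  rewrite Rintegral_itvZl; last exact: cc.
  have -> : i%:R - j%:R = ((i : int) - (j : int))%:~R :> R by rewrite rmorphB.
  rewrite integral_cos_period ?mulr0 // subr_eq0 eqz_nat.
  by apply: contraNneq ji => ij; apply/eqP/val_inj.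
rewrite addr0 Rintegral_itvZl; last exact: cc.
rewrite (@eq_Rintegral _ _ _ mu _ (cst 1)) => [|x _]; last by rewrite subrr mul0r cos0.
rewrite Rintegral_cst // mul1r /= lebesgue_measure_itv /= lte_fin.
have b_gt0 : 0 < b by rewrite mulr_gt0 ?pi_gt0 // ltr0n.
by rewrite gtrN // -EFinD /= opprK /b; ring.
Qed.

Lemma sqr_sum_le (M : nat) (a : 'I_M -> R) :
  (\sum_(i < M) a i) ^+ 2 <= M%:R * \sum_(i < M) a i ^+ 2.
Proof.
have -> : M%:R * \sum_(i < M) a i ^+ 2 =
    \sum_(i < M) \sum_(j < M) 2^-1 * (a i ^+ 2 + a j ^+ 2).
  under [RHS]eq_bigr => i _ do rewrite -mulr_sumr big_split /= sumr_const card_ord.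
  rewrite -mulr_sumr big_split /= sumr_const card_ord sumrMnl.
  move: (\sum_(i < M) a i ^+ 2) => Q.
  by rewrite -(mulr_natl Q M); field.
rewrite expr2 mulr_suml; apply: ler_sum => i _; rewrite mulr_sumr.
apply: ler_sum => j _; have := sqr_ge0 (a i - a j); rewrite sqrrB; lra.
Qed.

(** Modulating the coefficients by a cosine averages two translates of the
    trigonometric sum.  Writing 1 = (1 - phi) + phi with phi the combination of
    cosines, the first part is the residual sequence, and the energy of the
    second is bounded by translates of the energy of v by Cauchy-Schwarz. *)
Lemma energy_shift_le v (m M : nat) (c : nat -> R) (e s : R) x : (size v <= m)%N ->
  energy v x <= 2 * energy (\poly_(i < m)
    ((1 - \sum_(k < M) c k * cos ((s + k%:R) * (e * i%:R))) * v`_i)) x + M%:R * \sum_(k < M) c k ^+ 2 *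
    (energy v (x + (s + k%:R) * e) + energy v (x - (s + k%:R) * e)).
Proof.
move=> vm; set w := \poly_(i < m) _; have wm : (size w <= m)%N by exact: size_poly.
(* twice the cosine and sine parts of v modulated by the k-th cosine *)
pose al (k : 'I_M) := cos_sum v (x + (s + k%:R) * e) + cos_sum v (x - (s + k%:R) * e).
pose be (k : 'I_M) := sin_sum v (x + (s + k%:R) * e) + sin_sum v (x - (s + k%:R) * e).
have Hc : cos_sum v x = cos_sum w x + \sum_(k < M) c k * (2^-1 * al k).
  under [X in _ = _ + X]eq_bigr => k _.
    rewrite /al !(cos_sumE _ vm) -big_split /= 2!mulr_sumr.
    over.
  rewrite exchange_big /= (cos_sumE _ vm) (cos_sumE _ wm) -big_split /=.
  apply: eq_bigr => i _; rewrite coef_poly ltn_ord.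
  under [X in _ = _ + X]eq_bigr => k _.
    have -> : c k * (2^-1 * (v`_i * cos (i%:R * (x + (s + k%:R) * e)) +
      v`_i * cos (i%:R * (x - (s + k%:R) * e)))) =
      (v`_i * cos (i%:R * x)) * (c k * cos ((s + k%:R) * (e * i%:R))).
      have -> : i%:R * (x + (s + k%:R) * e) = i%:R * x + (s + k%:R) * (e * i%:R) by ring.
      have -> : i%:R * (x - (s + k%:R) * e) = i%:R * x - (s + k%:R) * (e * i%:R) by ring.
      by rewrite cosD cosB; field.
    over.
  by rewrite -mulr_sumr; ring.
have Hs : sin_sum v x = sin_sum w x + \sum_(k < M) c k * (2^-1 * be k).
  under [X in _ = _ + X]eq_bigr => k _.
    rewrite /be !(sin_sumE _ vm) -big_split /= 2!mulr_sumr.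
    over.
  rewrite exchange_big /= (sin_sumE _ vm) (sin_sumE _ wm) -big_split /=.
  apply: eq_bigr => i _; rewrite coef_poly ltn_ord.
  under [X in _ = _ + X]eq_bigr => k _.
    have -> : c k * (2^-1 * (v`_i * sin (i%:R * (x + (s + k%:R) * e)) +
      v`_i * sin (i%:R * (x - (s + k%:R) * e)))) =
      (v`_i * sin (i%:R * x)) * (c k * cos ((s + k%:R) * (e * i%:R))).
      have -> : i%:R * (x + (s + k%:R) * e) = i%:R * x + (s + k%:R) * (e * i%:R) by ring.
      have -> : i%:R * (x - (s + k%:R) * e) = i%:R * x - (s + k%:R) * (e * i%:R) by ring.
      by rewrite sinD sinB; field.
    over.
  by rewrite -mulr_sumr; ring.
rewrite [leLHS]/energy Hc Hs.
have two (a b : R) : (a + b) ^+ 2 <= 2 * a ^+ 2 + 2 * b ^+ 2.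
  by have := sqr_ge0 (a - b); rewrite sqrrB sqrrD; lra.
apply: (le_trans (lerD (two _ _) (two _ _))).
have al2 := sqr_sum_le (fun k => c k * (2^-1 * al k)).
have be2 := sqr_sum_le (fun k => c k * (2^-1 * be k)).
have : 2 * (M%:R * (\sum_(k < M) (c k * (2^-1 * al k)) ^+ 2)) +
       2 * (M%:R * (\sum_(k < M) (c k * (2^-1 * be k)) ^+ 2)) <=
    M%:R * \sum_(k < M) c k ^+ 2 *
    (energy v (x + (s + k%:R) * e) + energy v (x - (s + k%:R) * e)).
  rewrite ![2 * (_ * _)]mulrCA -mulrDr ler_wpM2l // !mulr_sumr -big_split /=.
  apply: ler_sum => k _; rewrite !exprMn /energy.
  have := two (cos_sum v (x + (s + k%:R) * e)) (cos_sum v (x - (s + k%:R) * e)).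
  have := two (sin_sum v (x + (s + k%:R) * e)) (sin_sum v (x - (s + k%:R) * e)).
  rewrite -/(al k) -/(be k) => h1 h2.
  rewrite [leLHS](_ : _ = c k ^+ 2 * (2^-1 * (al k ^+ 2 + be k ^+ 2))); last by field.
  by rewrite ler_wpM2l ?sqr_ge0 //; lra.
by move: al2 be2; rewrite /energy; lra.
Qed.

End energy.

(** * Uncertainty principle *)
Section uncertainty.
Context {R : realType}.
Local Notation mu := (@lebesgue_measure R).
Implicit Types (v : {poly R}).

(** Time is measured in units of n steps, so the coefficients of v sit at times
    in [0, P] and the variable x is a frequency.  On this time interval 1 is
    approximated up to 1/2 by cosines of frequencies at least 2 H
    (high_frequency_approx_1).  The residual sequence is at most half of v, so
    by Parseval it carries at most a quarter of the total energy; the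
    translates by the high frequencies move [-H, H] into the region beyond H.
    Hence the energy in the hole is at most half of the total plus a multiple
    of the energy outside, and it can be absorbed.  The constant does not
    depend on n. *)
Lemma energy_uncertainty (P : nat) (H : R) : (0 < P)%N -> 0 < H ->
  exists (C : R) (n0 : nat), [/\ 0 < C, (0 < n0)%N & forall n v, (n0 <= n)%N ->
    (size v <= P * n)%N ->
    H <= pi * n%:R /\
    \int[mu]_(x in `[- (pi * n%:R), pi * n%:R]) energy v (x / n%:R) <=
    C * \int[mu]_(x in `[H, pi * n%:R]) energy v (x / n%:R)].
Proof.
move=> P0 H0; have [x0 x0_gt0 Hx0] := @high_frequency_approx_1 R.
have P0' : 0 < P%:R :> R by rewrite ltr0n.
(* frequency step: times in [0, P] become angles of modulus at most x0 *)
pose dl := x0 / P%:R; have dl0 : 0 < dl by rewrite divr_gt0.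
(* all frequencies used are at least N dl >= 2 H, so x + N dl >= H on [-H, H] *)
pose N := (Num.truncn (2 * H / dl)).+1.
have NH : 2 * H <= N%:R * dl.
  by rewrite -ler_pdivrMr // ltW // truncnS_gt.
have [M [c Hc]] := Hx0 N.
pose S2 := \sum_(k < M) c k ^+ 2.
have S20 : 0 <= S2 by apply: sumr_ge0 => k _; exact: sqr_ge0.
(* for n >= n0 the translates of [-H, H] stay inside one period *)
pose n0 := (Num.truncn ((N + M)%:R * dl + H)).+1.
exists (4 + 4 * (M%:R * S2)), n0; split => //.
  by rewrite ltr_pwDl // !mulr_ge0.
move=> n v nn0 vn; set b := pi * n%:R.
have n_gt0 : (0 < n)%N by rewrite (leq_trans _ nn0).
have n_gt0' : 0 < n%:R :> R by rewrite ltr0n.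
have bge : (N + M)%:R * dl + H <= b.
  rewrite (@le_trans _ _ n0%:R) //; first by rewrite ltW // truncnS_gt.
  rewrite (@le_trans _ _ n%:R) ?ler_nat // ler_peMl //.
  by rewrite (le_trans _ (pi_ge2 R)) // ler1n.
have NM0 : 0 <= (N + M)%:R * dl by rewrite mulr_ge0 // ltW.
have Hb : H <= b by lra.
split=> //.
pose E x := energy v (x / n%:R).
have cE : continuous E by exact: energy_scaled_continuous.
have E0 x : 0 <= E x by exact: energy_ge0.
have EN x : E (- x) = E x by rewrite /E mulNr energyN.
set O := \int[mu]_(x in `[H, b]) _.
have O0 : 0 <= O by apply: Rintegral_ge0 => x _; exact: E0.
pose hole := \int[mu]_(x in `[- H, H]) E x.
have total : \int[mu]_(x in `[- b, b]) E x = hole + 2 * O.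
  rewrite (Rintegral_itv_cat (b := - H)) //; last by rewrite lerN2 Hb /=; lra.
  rewrite (Rintegral_itv_cat (a := - H) (b := H)) //; last by rewrite Hb andbT; lra.
  rewrite -(Rintegral_itv_opp H b cE) (@eq_Rintegral _ _ _ mu _ E) => [|x _]; last exact: EN.
  by rewrite -/O -/hole; ring.
rewrite -/E total.
pose sft (k : nat) := (N%:R + k%:R) * dl.
have cEs s : continuous (fun x => E (x + s)).
  move=> x; apply: (@continuous_comp _ _ _ (fun x => x + s) E); last exact: cE.
  by apply: cvgD; [exact: cvg_id|exact: cvg_cst].
have shiftP (k : nat) : (k < M)%N -> \int[mu]_(x in `[- H, H]) E (x + sft k) <= O.
  move=> kM; rewrite Rintegral_itv_translate //; apply: Rintegral_itv_subset => //.
    have : 0 <= k%:R * dl by rewrite mulr_ge0 // ltW.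
    by rewrite /sft mulrDl; lra.
  have : sft k <= (N + M)%:R * dl.
    by rewrite /sft natrD ler_wpM2r ?(ltW dl0) // lerD2l ler_nat ltnW.
  lra.
have shiftN (k : nat) : (k < M)%N -> \int[mu]_(x in `[- H, H]) E (x - sft k) <= O.
  move=> kM; apply: le_trans (shiftP k kM).
  have := Rintegral_itv_opp (- H) H (cEs (- sft k)); rewrite opprK => <-.
  rewrite (@eq_Rintegral _ _ _ mu _ (fun x => E (x + sft k))) // => x _.
  by rewrite -opprD EN.
pose m := (P * n)%N.
pose w := \poly_(i < m)
  ((1 - \sum_(k < M) c k * cos ((N%:R + k%:R) * (dl / n%:R * i%:R))) * v`_i).
have wm : (size w <= m)%N by exact: size_poly.
pose W x := energy w (x / n%:R).
have cW : continuous W by exact: energy_scaled_continuous.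
have Wle : \int[mu]_(x in `[- H, H]) W x <= 4^-1 * (hole + 2 * O).
  rewrite -total; apply: (@le_trans _ _ (\int[mu]_(x in `[- b, b]) W x)).
    by apply: Rintegral_itv_subset => //; [move=> x; exact: energy_ge0|lra].
  rewrite (energy_parseval n_gt0 wm) (energy_parseval n_gt0 vn) mulrCA.
  rewrite ler_wpM2l ?mulr_ge0 ?pi_ge0 // mulr_sumr; apply: ler_sum => i _.
  rewrite coef_poly ltn_ord exprMn ler_wpM2r ?sqr_ge0 //.
  have : `|dl / n%:R * i%:R| <= x0.
    rewrite ger0_norm; last by rewrite !mulr_ge0 ?invr_ge0 // ltW.
    rewrite /dl -!mulrA -[leRHS]mulr1 ler_pM2l //.
    rewrite mulrA -invfM -natrM mulrC ler_pdivrMr ?ltr0n ?muln_gt0 ?P0 //.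
    by rewrite mul1r ler_nat ltnW.
  move=> /Hc; under eq_bigr => k _ do rewrite natrD.
  by rewrite ler_norml => /andP[]; move: (1 - _) => y y1 y2; nra.
have ptw x : E x <= 2 * W x + M%:R * \sum_(k < M) c k ^+ 2 *
    (E (x + sft k) + E (x - sft k)).
  have := @energy_shift_le R v m M c (dl / n%:R) N%:R (x / n%:R) vn; rewrite -/w.
  move/le_trans; apply; rewrite lerD2l ler_wpM2l //; apply: ler_sum => k _.
  rewrite /E /sft.
  have -> : (x + (N%:R + k%:R) * dl) / n%:R = x / n%:R + (N%:R + k%:R) * (dl / n%:R) by ring.
  by have -> : (x - (N%:R + k%:R) * dl) / n%:R = x / n%:R - (N%:R + k%:R) * (dl / n%:R) by ring.
have cF : continuous (fun x => \sum_(k < M) c k ^+ 2 * (E (x + sft k) + E (x - sft k))).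
  apply: continuous_sum => k x; apply: cvgM; first exact: cvg_cst.
  by apply: cvgD; exact: cEs.
have c2W : continuous (fun x => 2 * W x).
  by move=> x; apply: cvgM; [exact: cvg_cst|exact: cW].
have cMF : continuous (fun x => M%:R * \sum_(k < M) c k ^+ 2 * (E (x + sft k) + E (x - sft k))).
  by move=> x; apply: cvgM; [exact: cvg_cst|exact: cF].
have holeP : hole <= 2 * \int[mu]_(x in `[- H, H]) W x + M%:R * (S2 * (2 * O)).
  apply: (@le_trans _ _ (\int[mu]_(x in `[- H, H]) (2 * W x +
     M%:R * \sum_(k < M) c k ^+ 2 * (E (x + sft k) + E (x - sft k))))).
    apply: continuous_le_Rintegral => // x; apply: cvgD; [exact: c2W|exact: cMF].
  rewrite RintegralD //; [|exact: continuous_integrable_itv|exact: continuous_integrable_itv].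
  rewrite !Rintegral_itvZl // lerD2l ler_wpM2l //.
  rewrite Rintegral_sum_itv; last first.
    move=> k x; apply: cvgM; first exact: cvg_cst.
    by apply: cvgD; exact: cEs.
  rewrite mulr_suml; apply: ler_sum => k _.
  rewrite Rintegral_itvZl; last by move=> x; apply: cvgD; exact: cEs.
  rewrite ler_wpM2l ?sqr_ge0 // RintegralD //;
    [|exact: continuous_integrable_itv|exact: continuous_integrable_itv].
  by have := shiftP k (ltn_ord k); have := shiftN k (ltn_ord k); lra.
have : 0 <= M%:R * S2 * O by rewrite !mulr_ge0.
have -> : (4 + 4 * (M%:R * S2)) * O = 4 * O + 4 * (M%:R * S2 * O) by ring.
have : M%:R * (S2 * (2 * O)) = 2 * (M%:R * S2 * O) by ring.
move: (M%:R * S2 * O) => Y; lra.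
Qed.

End uncertainty.

(** * Window sums and partial sums *)
Section summation.
Context {R : realType}.
Implicit Types (u v : {poly R}).

(** On [0, 1] the mean value theorem gives sin x >= x cos 1; on [1, pi / 2] the
    sine is at least sin 1 >= cos 1 while x <= 2. *)
Lemma sin_ge_linear (x : R) : 0 <= x <= pi / 2 -> cos 1 / 2 * x <= sin x.
Proof.
have c1 := @cos1_gt0 R; have ph2 := @pihalf_lt2 R; have ph1 := @pihalf_ge1 R.
have small (y : R) : 0 <= y <= 1 -> cos 1 * y <= sin y.
  move=> /andP[y0 y1].
  have [z zy] := @MVT_segment R (@sin R) (@cos R) 0 y y0 (fun z _ => is_derive_sin z)
    (continuous_subspaceT (@continuous_sin R)).
  rewrite sin0 !subr0 => ->; rewrite ler_wpM2r //.
  move: zy; rewrite in_itv /= => /andP[z0 zy].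
  have pi2 := pi_ge2 R.
  by rewrite leNgt ltr_cos ?in_itv /= -?leNgt; lra.
move=> /andP[x0 x1]; have [x1'|x1'] := leP x 1.
  by apply: le_trans (small x _); [rewrite ler_wpM2r // | rewrite x0]; lra.
have s1 := small 1; rewrite mulr1 in s1.
apply: (@le_trans _ _ (cos 1)); first by nra.
apply: (le_trans (s1 _)); first lra.
by rewrite leNgt ltr_sin ?in_itv /= -?leNgt; lra.
Qed.

Lemma two_sub_2cos_ge (x : R) : 0 <= x <= pi -> cos 1 ^+ 2 / 4 * x ^+ 2 <= 2 - 2 * cos x.
Proof.
move=> /andP[x0 x1].
have -> : 2 - 2 * cos x = (2 * sin (x / 2)) ^+ 2.
  have -> : cos x = cos (x / 2 *+ 2) by congr cos; rewrite -mulr_natr divfK.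
  by rewrite cos_mulr2n cos2sin2; ring.
have -> : cos 1 ^+ 2 / 4 * x ^+ 2 = (2 * (cos 1 / 2 * (x / 2))) ^+ 2 by field.
have c1 := @cos1_gt0 R.
rewrite lerXn2r ?nnegrE ?ler_wpM2l //.
- by rewrite !mulr_ge0 // ?divr_ge0 // ltW.
- by rewrite mulr_ge0 // sin_ge0_pi //; lra.
- by apply: sin_ge_linear; lra.
Qed.

(** The factor 1 + X + ... + X^(n-1) replaces a sequence by its sums over sliding
    windows of length n.  Since it equals (1 - X^n) / (1 - X), its p-th power
    behaves as p summations but keeps a bounded support, of length (p + 1) n. *)
Definition window_sum (n p : nat) u := (\sum_(j < n) 'X^j) ^+ p * u.

Lemma size_window_sum n p u : (0 < n)%N -> (size u <= n)%N ->
  (size (window_sum n p u) <= p.+1 * n)%N.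
Proof.
move=> n0 un; have sA : (size (\sum_(j < n) 'X^j : {poly R})%R <= n)%N.
  apply: (leq_trans (size_sum _ _ _)); apply/bigmax_leqP => j _.
  by rewrite size_polyXn.
elim: p => [|p IH]; first by rewrite /window_sum expr0 !mul1r mul1n.
rewrite /window_sum exprS -mulrA; apply: (leq_trans (size_polyMleq _ _)).
rewrite -/(window_sum n p u) [in leqRHS]mulSn.
by apply: (leq_trans (leq_pred _)); apply: leq_add.
Qed.

Lemma one_subX_window_sum n p u :
  (1 - 'X) ^+ p * window_sum n p u = (1 - 'X^n) ^+ p * u.
Proof.
rewrite /window_sum mulrA -exprMn; congr (_ ^+ p * _).
rewrite -[1 - 'X]opprB mulNr -subrX1 opprB //.
Qed.

Lemma energy_1subXn_exp k p v x :
  energy ((1 - 'X^k) ^+ p * v) x = (2 - 2 * cos (k%:R * x)) ^+ p * energy v x.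
Proof.
elim: p => [|p IH]; first by rewrite !expr0 !mul1r.
by rewrite exprS -mulrA energy_mul_1subXn IH mulrA -exprS.
Qed.

(** From (1 - X)^p V = (1 - X^n)^p U: on the left |1 - e^(ix)|^2 is at least a
    multiple of x^2, on the right |1 - e^(inx)|^2 is at most 4.  So the window
    sums compensate a spectral density of order x^(-2p). *)
Lemma energy_window_sum_le n p u x : 0 <= x <= pi ->
  (cos 1 ^+ 2 / 4 * x ^+ 2) ^+ p * energy (window_sum n p u) x <= 4 ^+ p * energy u x.
Proof.
move=> x01; have c1 := @cos1_gt0 R.
have := congr1 (fun v => energy v x) (one_subX_window_sum n p u).
rewrite /= energy_1subXn_exp -['X]expr1 energy_1subXn_exp mul1r => E.
apply: (@le_trans _ _ ((2 - 2 * cos (n%:R * x)) ^+ p * energy u x)).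
  rewrite -E ler_wpM2r ?energy_ge0 //; apply: lerXn2r; rewrite ?nnegrE.
  - by rewrite mulr_ge0 ?sqr_ge0 // divr_ge0 ?sqr_ge0.
  - by have := cos_le1 x; lra.
  - exact: two_sub_2cos_ge.
rewrite ler_wpM2r ?energy_ge0 //; apply: lerXn2r; rewrite ?nnegrE //;
  by have := cos_le1 (n%:R * x); have := cos_geN1 (n%:R * x); lra.
Qed.

(** One difference multiplies the sum of the squares of the first m
    coefficients by at most 4, as (a - b)^2 <= 2 a^2 + 2 b^2. *)
Lemma coef_1subX_sqr_sum_le p v (m : nat) :
  \sum_(i < m) ((1 - 'X) ^+ p * v)`_i ^+ 2 <= 4 ^+ p * \sum_(i < m) v`_i ^+ 2.
Proof.
elim: p => [|p IH]; first by rewrite expr0 !mul1r.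
rewrite exprS -mulrA; set w := _ ^+ p * v.
rewrite [4 ^+ _]exprS -mulrA; apply: (@le_trans _ _ (4 * \sum_(i < m) w`_i ^+ 2));
  last by rewrite ler_wpM2l.
have -> : 4 * \sum_(i < m) w`_i ^+ 2 = 2 * \sum_(i < m) w`_i ^+ 2 + 2 * \sum_(i < m) w`_i ^+ 2.
  by rewrite -mulrDl; congr (_ * _); lra.
have shift (k : nat) : \sum_(i < k) (('X * w)`_i) ^+ 2 <= \sum_(i < k) w`_i ^+ 2.
  case: k => [|k]; first by rewrite !big_ord0.
  rewrite big_ord_recl coefXM /= expr0n add0r [leRHS]big_ord_recr /=.
  under eq_bigr => i _ do rewrite coefXM /=.
  by rewrite lerDl sqr_ge0.
apply: (@le_trans _ _ (2 * \sum_(i < m) w`_i ^+ 2 + 2 * \sum_(i < m) (('X * w)`_i) ^+ 2)).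
  rewrite !mulr_sumr -big_split /=; apply: ler_sum => i _.
  rewrite mulrBl mul1r coefB; have := sqr_ge0 (w`_i + ('X * w)`_i).
  by rewrite sqrrB sqrrD; lra.
by rewrite lerD2l ler_wpM2l.
Qed.

(** Taking p differences of the (p + 1)-fold window sums leaves the simple
    window sums times (1 - X^n)^p.  Below degree n this last factor is invisible,
    and a window ending at t < n contains exactly the coefficients 0, ..., t. *)
Lemma partial_sum_sqr_le n p u (t : nat) : (t < n)%N ->
  (\sum_(i < t.+1) u`_i) ^+ 2 <=
    4 ^+ p * \sum_(i < n) (window_sum n p.+1 u)`_i ^+ 2.
Proof.
move=> tn; apply: le_trans (coef_1subX_sqr_sum_le p _ n).
have -> : (1 - 'X) ^+ p * window_sum n p.+1 u =
    (1 - 'X^n) ^+ p * window_sum n 1 u.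
  rewrite {1}/window_sum exprS -mulrA -/(window_sum n p u) mulrCA.
  by rewrite one_subX_window_sum mulrCA /window_sum expr1.
have coefE (w : {poly R}) : ((1 - 'X^n) ^+ p * w)`_t = w`_t.
  elim: p w => [|q IH] w; first by rewrite expr0 mul1r.
  by rewrite exprSr -mulrA IH mulrBl mul1r coefB coefXnM tn subr0.
rewrite (bigD1 (Ordinal tn)) //= coefE.
have -> : (window_sum n 1 u)`_t = \sum_(i < t.+1) u`_i.
  rewrite /window_sum expr1 coefM; apply: etrans (_ : \sum_(i < t.+1) u`_(t - i) = _).
    apply: eq_bigr => i _; rewrite coef_sum.
    have ti : (i < n)%N by apply: leq_ltn_trans tn; rewrite -ltnS.
    rewrite (bigD1 (Ordinal ti)) //= coefXn eqxx big1 ?addr0 ?mul1r // => j ji.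
    rewrite coefXn; case: eqP => // ij; case/eqP: ji; exact/val_inj.
  rewrite (reindex_inj rev_ord_inj) /=; apply: eq_bigr => i _.
  by rewrite subSS subKn // -ltnS.
by rewrite lerDl; apply: sumr_ge0 => i _; exact: sqr_ge0.
Qed.

(** The pairing with the step is the full sum minus twice the partial sum up to
    the change point. *)
Lemma step_sqr_le n p u (t : nat) : (0 < t <= n)%N -> (0 < p)%N ->
  (\sum_(k < n) u`_k * zeta t k) ^+ 2 <=
    10 * 4 ^+ p * \sum_(i < n) (window_sum n p u)`_i ^+ 2.
Proof.
case: p => // p /andP[t0 tn] _.
case: t t0 tn => // t _ tn; have n0 : (0 < n)%N by apply: leq_trans tn.
have -> : \sum_(k < n) u`_k * zeta t.+1 k =
    \sum_(i < n.-1.+1) u`_i - 2 * \sum_(i < t.+1) u`_i.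
  rewrite prednK // mulr_sumr (big_ord_widen n (fun i => 2 * u`_i) tn).
  rewrite [X in _ = _ - X]big_mkcond -sumrB; apply: eq_bigr => k _.
  by rewrite /zeta ltnS; case: ifP => _; ring.
set a := \sum_(i < n.-1.+1) _; set b := \sum_(i < t.+1) _.
have ha : a ^+ 2 <= _ := partial_sum_sqr_le p u (t := n.-1) (n := n) _.
have hb : b ^+ 2 <= _ := partial_sum_sqr_le p u tn.
move: ha hb; rewrite [4 ^+ p.+1]exprS; set Q := \sum_(i < n) _ => ha hb.
have {}ha := ha (ltac:(by rewrite prednK)).
have Q0 : 0 <= 4 ^+ p * Q by rewrite mulr_ge0 ?exprn_ge0 // sumr_ge0 // => i _; rewrite sqr_ge0.
have -> : 10 * (4 * 4 ^+ p) * Q = 40 * (4 ^+ p * Q) by ring.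
have := sqr_ge0 (a + 2 * b); rewrite sqrrB sqrrD !exprMn; move: ha hb Q0.
move: (4 ^+ p * Q) => Y; lra.
Qed.

End summation.

(** * Quadratic forms of a covariance function *)
Section covariance_form.
Context {R : realType}.
Local Notation mu := (@lebesgue_measure R).
Variables (K : R -> R) (n : nat) (x u : 'I_n -> R).

Definition cov_form (y : R) : R :=
  \sum_(i < n) \sum_(j < n) u i * u j * K (x i - x j + y).

(** Positive semidefiniteness on the 2 n points x_i and x_i - y with weights u_i
    and s u_i, for s = 1 and s = -1: a positive definite function is maximal at
    the origin. *)
Lemma cov_form_max : covariance_function K -> forall y, `|cov_form y| <= cov_form 0.
Proof.
move=> [Keven Kpsd] y.
have cov_formN : cov_form (- y) = cov_form y.
  rewrite /cov_form exchange_big /=; apply: eq_bigr => i _; apply: eq_bigr => j _.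
  by rewrite -Keven [u j * _]mulrC; congr (_ * K _); ring.
have H (s : R) : s ^+ 2 = 1 -> 0 <= cov_form 0 + cov_form 0 + s * (cov_form y + cov_form (- y)).
  move=> s2.
  (* the doubled configuration of points and weights *)
  pose X (k : 'I_(n + n)) := match fintype.split k with inl i => x i | inr i => x i - y end.
  pose U (k : 'I_(n + n)) := match fintype.split k with inl i => u i | inr i => s * u i end.
  have := Kpsd (n + n)%N X U.
  rewrite big_split_ord /=.
  under eq_bigr => i _ do rewrite big_split_ord /=.
  under [X in _ + X]eq_bigr => i _ do rewrite big_split_ord /=.
  rewrite !big_split /=.
  have XL i : X (lshift n i) = x i by rewrite /X (unsplitK (inl i)).
  have XR i : X (rshift n i) = x i - y by rewrite /X (unsplitK (inr i)).
  have UL i : U (lshift n i) = u i by rewrite /U (unsplitK (inl i)).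
  have UR i : U (rshift n i) = s * u i by rewrite /U (unsplitK (inr i)).
  move/le_trans; apply; rewrite le_eqVlt; apply/orP; left; apply/eqP.
  have -> : cov_form 0 + cov_form 0 + s * (cov_form y + cov_form (- y)) =
    (cov_form 0 + s * cov_form y) + (s * cov_form (- y) + cov_form 0) by ring.
  rewrite /cov_form !mulr_sumr.
  congr (_ + _ + (_ + _)); apply: eq_bigr => i _; rewrite ?mulr_sumr;
    apply: eq_bigr => j _; rewrite ?XL ?XR ?UL ?UR.
  - by rewrite addr0.
  - by rewrite mulrCA -!mulrA; congr (_ * (_ * (_ * K _))); ring.
  - by rewrite -!mulrA; congr (_ * (_ * (_ * K _))); ring.
  - rewrite mulrACA -expr2 s2 mul1r; congr (_ * K _); ring.
have := H 1; rewrite expr1n => /(_ erefl); have := H (-1); rewrite sqrrN expr1n => /(_ erefl).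
by rewrite cov_formN ler_norml => h1 h2; apply/andP; split; lra.
Qed.

End covariance_form.

(** * Fejer kernels *)
Section fejer.
Context {R : realType}.
Local Notation mu := (@lebesgue_measure R).
Implicit Types (b w y : R).

Lemma is_derive_fejer b y w : b != 0 -> y != 0 ->
  is_derive w (1 : R) (fun w => (1 - w / b) * sin (y * w) / y - cos (y * w) / (b * y ^+ 2))
    ((1 - w / b) * cos (w * y)).
Proof.
move=> b0 y0.
have d1 : is_derive w (1 : R) (fun w => 1 - b^-1 * w) (- b^-1).
  have -> : (fun w => 1 - b^-1 * w) = cst 1 - b^-1 \*: (@id R) by [].
  by apply: is_derive_eq; rewrite /GRing.scale /= sub0r mulr1.
have d2 := @is_deriveZ _ _ _ _ y^-1 _ _ _ (is_deriveM d1 (is_derive_sin_scale y w)).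
have d3 := @is_deriveZ _ _ _ _ (b * y ^+ 2)^-1 _ _ _ (is_derive_cos_scale y w).
have d4 := is_deriveB d2 d3.
have -> : (fun w => (1 - w / b) * sin (y * w) / y - cos (y * w) / (b * y ^+ 2)) =
  (y^-1 \*: ((fun w => 1 - b^-1 * w) * (fun w => sin (y * w))))
  - ((b * y ^+ 2)^-1 \*: (fun w => cos (y * w))).
  by apply/funext => z; rewrite !fctE /=; rewrite /GRing.scale /=; ring.
refine (is_derive_eq d4 _); rewrite /GRing.scale /= [w * y]mulrC; field.
by rewrite b0 y0.
Qed.

(** The cosine transform of the triangle of base [0, b], which is a Fejer kernel
    up to normalization. *)
Definition fejer b y := \int[mu]_(w in `[0, b]) ((1 - w / b) * cos (w * y)).

Lemma fejer_integrand_continuous b y : continuous (fun w : R => (1 - w / b) * cos (w * y)).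
Proof.
move=> w; apply: cvgM.
  apply: cvgB; first exact: cvg_cst.
  by apply: cvgM; [exact: cvg_id|exact: cvg_cst].
apply: (@continuous_comp _ _ _ (fun w => w * y) (@cos R)); last exact: continuous_cos.
by apply: cvgM; [exact: cvg_id|exact: cvg_cst].
Qed.

Lemma fejerE b y : 0 < b -> y != 0 -> fejer b y = (1 - cos (b * y)) / (b * y ^+ 2).
Proof.
move=> b0 y0; have b0' := lt0r_neq0 b0.
transitivity (((1 - b / b) * sin (y * b) / y - cos (y * b) / (b * y ^+ 2)) -
  ((1 - 0 / b) * sin (y * 0) / y - cos (y * 0) / (b * y ^+ 2))).
  apply: (@Rintegral_FTC2 _ _ (fun w => (1 - w / b) * sin (y * w) / y - cos (y * w) / (b * y ^+ 2))).
  - exact: ltW.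
  - exact: fejer_integrand_continuous.
  - by move=> w; exact: is_derive_fejer.
rewrite divff // subrr !mul0r mulr0 sin0 cos0 [y * b]mulrC; field.
by rewrite b0' y0.
Qed.

(** The kernel is at most b everywhere and at most 2 / (b y^2) away from 0; the
    Cauchy density dominates both regimes and has an explicit integral. *)
Lemma fejer_le b y : 0 < b -> `|fejer b y| <= 3 * (b * (1 + (b * y) ^+ 2)^-1).
Proof.
move=> b0.
have h1 : `|fejer b y| <= b.
  apply: (le_trans (le_normr_Rintegral _ _)) => //.
    exact/continuous_integrable_itv/fejer_integrand_continuous.
  apply: (@le_trans _ _ (\int[mu]_(w in `[0, b]) 1)).
    apply: continuous_le_Rintegral.
    - by move=> w; apply: cvg_norm; exact: fejer_integrand_continuous.
    - by move=> w; exact: cvg_cst.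
    - move=> w /andP[w0 wb]; rewrite normrM -[leRHS]mulr1 ler_pM // ?cos_max //.
      have : w / b <= 1 by rewrite ler_pdivrMr // mul1r.
      have : 0 <= w / b by rewrite divr_ge0 // ltW.
      by move=> ? ?; rewrite ger0_norm; lra.
  by rewrite Rintegral_cst // mul1r /= lebesgue_measure_itv /= lte_fin b0 oppr0 adde0.
have h2 : `|fejer b y| * (b * y) ^+ 2 <= 2 * b.
  have [->|y0] := eqVneq y 0; first by rewrite mulr0 expr0n mulr0; lra.
  rewrite fejerE // normrM [`|_^-1|]ger0_norm; last first.
    by rewrite invr_ge0 mulr_ge0 ?sqr_ge0 // ltW.
  have -> : `|1 - cos (b * y)| / (b * y ^+ 2) * (b * y) ^+ 2 = `|1 - cos (b * y)| * b.
    by field; rewrite y0 lt0r_neq0.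
  rewrite ler_wpM2r ?(ltW b0) //.
  have := cos_le1 (b * y); have := cos_geN1 (b * y) => ? ?.
  by rewrite ger0_norm; lra.
have d0 : 0 < 1 + (b * y) ^+ 2 by rewrite ltr_pwDl // sqr_ge0.
by rewrite mulrA ler_pdivlMr //; lra.
Qed.

Lemma cauchy_density_integral b : 0 < b ->
  (\int[mu]_y (b * (1 + (b * y) ^+ 2)^-1)%:E = pi%:E)%E.
Proof.
move=> b0.
have cf : continuous (fun y : R => b * (1 + (b * y) ^+ 2)^-1).
  move=> y; apply: cvgM; first exact: cvg_cst.
  apply: cvgV; first by rewrite lt0r_neq0 // ltr_pwDl // sqr_ge0.
  apply: cvgD; first exact: cvg_cst.
  by apply: (@continuous_comp _ _ _ (fun y => b * y) (fun z : R => z ^+ 2));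
    [exact: continuous_scale|exact: exprn_continuous].
have f0 y : 0 <= b * (1 + (b * y) ^+ 2)^-1.
  by rewrite mulr_ge0 ?invr_ge0 ?addr_ge0 ?sqr_ge0 // ltW.
rewrite ge0_symfun_integralT //; last by move=> y /=; rewrite mulrN sqrrN.
have dat y : is_derive y (1 : R) (fun y => atan (b * y)) ((1 + (b * y) ^+ 2)^-1 * b).
  apply: (@is_derive1_comp _ (@atan R) (fun y => b * y) _ _ _ _ (is_derive_scale b y)).
rewrite -set_itvcy (@ge0_continuous_FTC2y _ _ (fun y => atan (b * y)) 0 (pi / 2)) //.
- by rewrite mulr0 atan0 sube0 -EFinM; congr EFin; field.
- exact: continuous_subspaceT.
- apply: (@cvg_comp _ _ _ (fun y => b * y) (@atan R) _ (+oo_ R)); last exact: cvgy_atan.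
  by apply: gt0_cvgMry => //; exact: cvg_id.
- apply: cvg_at_right_filter; apply: (@continuous_comp _ _ _ (fun y => b * y) (@atan R)).
    exact: continuous_scale.
  exact: continuous_atan.
- by move=> y _; rewrite derive1E derive_val mulrC.
Qed.

End fejer.

Section fubini.
Context {R : realType}.
Local Notation mu := (@lebesgue_measure R).

(** Fubini for real-valued integrals: all sections are assumed integrable, so
    that no section has an infinite integral hidden by the projection to R. *)
Lemma Rintegral_fubini (f : measurableTypeR R * measurableTypeR R -> R) :
  (mu \x mu)%E.-integrable setT (EFin \o f) ->
  (forall x, mu.-integrable setT (fun y => (f (x, y))%:E)) ->
  (forall y, mu.-integrable setT (fun x => (f (x, y))%:E)) ->
  mu.-integrable setT (EFin \o (fun x => \int[mu]_y f (x, y))) /\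
  \int[mu]_x \int[mu]_y f (x, y) = \int[mu]_y \int[mu]_x f (x, y).
Proof.
move=> fi f1 f2.
have E1 x : (\int[mu]_y (f (x, y))%:E = (\int[mu]_y f (x, y))%:E)%E.
  by rewrite /Rintegral fineK //; exact: integrable_fin_num.
have E2 y : (\int[mu]_x (f (x, y))%:E = (\int[mu]_x f (x, y))%:E)%E.
  by rewrite /Rintegral fineK //; exact: integrable_fin_num.
split.
  have := integrable_fubini_F fi; congr (mu.-integrable _ _).
  by apply/funext => x; rewrite /fubini_F /= E1.
have := Fubini fi => /= h; rewrite /Rintegral; congr fine.
rewrite -[LHS](_ : (\int[mu]_x \int[mu]_y (f (x, y))%:E)%E = _); last first.
  by apply: eq_integral => x _; rewrite E1.
by rewrite h; apply: eq_integral => y _; rewrite E2.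
Qed.

Lemma integrable_le (f g : measurableTypeR R -> R) : measurable_fun setT f ->
  mu.-integrable setT (EFin \o g) -> (forall x, `|f x| <= g x) ->
  mu.-integrable setT (EFin \o f).
Proof.
move=> mf gi fg; apply: le_integrable gi => //; first exact/measurable_EFinP.
by move=> x _ /=; rewrite lee_fin (le_trans (fg x)) // ler_norm.
Qed.

Lemma integrable_indic_itv (a b c : R) :
  mu.-integrable setT (EFin \o (fun x => c * \1_`[a, b] x)).
Proof.
have h : mu.-integrable `[a, b] (EFin \o (fun=> c)).
  by apply: continuous_integrable_itv => x; exact: cvg_cst.
have := (integrable_mkcond (mu := mu) (D := `[a, b]%classic) (EFin \o (fun=> c)) (measurable_itv `[a, b])).1 h; congr (mu.-integrable _ _).
apply/funext => x; rewrite /patch /= indicE; case: ifP => _; by rewrite ?mulr1 ?mulr0.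
Qed.

Lemma measurable_inv : measurable_fun setT (@GRing.inv R : measurableTypeR R -> measurableTypeR R).
Proof.
have -> : [set: measurableTypeR R] = [set 0] `|` ~` [set 0] by rewrite setUv.
apply/measurable_funU; [exact: measurable_set1|by apply: measurableC; exact: measurable_set1|].
split; first exact: measurable_fun_set1.
apply: open_continuous_measurable_fun.
  by apply: closed_openC; exact: closed_eq.
move=> y; rewrite inE /= => /eqP y0.
by apply: cvgV => //; exact: cvg_id.
Qed.

End fubini.

Section fejer_norm.
Context {R : realType}.
Local Notation mu := (@lebesgue_measure R).

Lemma fejer_bound (b : R) : 0 < b -> forall y : R, `|fejer b y| <= 3 * b.
Proof.
move=> b0 y; apply: (le_trans (fejer_le _ b0)); rewrite ler_pM2l // ler_piMr ?(ltW b0) //.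
by rewrite invf_le1 ?lerDl ?sqr_ge0 // ltr_pwDl // sqr_ge0.
Qed.

Lemma measurable_fejer (b : R) : 0 < b -> measurable_fun setT (fejer b).
Proof.
move=> b0; have -> : fejer b = fun y => if y == 0 then fejer b 0 else (1 - cos (b * y)) / (b * y ^+ 2).
  by apply/funext => y; case: eqP => [->//|/eqP y0]; rewrite fejerE.
apply: measurable_fun_ifT; [exact: measurable_fun_eqr|exact: measurable_cst|].
apply: measurable_funM.
  apply: measurable_funB; first exact: measurable_cst.
  by apply: continuous_measurable_fun; exact: continuous_cos_scale.
apply: (measurableT_comp measurable_inv).
by apply: measurable_funM; [exact: measurable_cst|exact: measurable_funX].
Qed.

(** The L1 norm of a Fejer kernel is bounded independently of b.  The constant
    comes from domination by three times a Cauchy profile of mass pi. *)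
Lemma fejer_pairing_le (b k0 : R) (k : R -> R) : 0 < b ->
  measurable_fun setT k -> (forall y, `|k y| <= k0) ->
  `|\int[mu]_y (fejer b y * k y)| <= 3 * pi * k0.
Proof.
move=> b0 mk kk0; have k0_ge0 : 0 <= k0 := le_trans (normr_ge0 _) (kk0 0).
pose h y := b * (1 + (b * y) ^+ 2)^-1.
have h0 y : 0 <= h y by rewrite mulr_ge0 ?invr_ge0 ?addr_ge0 ?sqr_ge0 // ltW.
pose g y := 3 * k0 * h y.
have f_g y : `|fejer b y * k y| <= g y.
  rewrite normrM /g mulrAC [leRHS]mulrC [leRHS]mulrC; apply: ler_pM => //.
  exact: fejer_le.
have hi : mu.-integrable setT (EFin \o h).
  apply/integrableP; split.
    apply/measurable_EFinP; apply: measurable_funM; first exact: measurable_cst.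
    apply: (measurableT_comp measurable_inv).
    apply: measurable_funD; first exact: measurable_cst.
    by apply: measurable_funX; apply: measurable_funM; [exact: measurable_cst|exact: measurable_id].
  under eq_integral do rewrite gee0_abs ?lee_fin //.
  by rewrite cauchy_density_integral // ltry.
have gi : mu.-integrable setT (EFin \o g).
  have := integrableZl measurableT (3 * k0) hi; congr (mu.-integrable _ _).
have fki : mu.-integrable setT (EFin \o (fun y => fejer b y * k y)).
  apply: integrable_le gi f_g.
  by apply: measurable_funM; [exact: measurable_fejer|exact: mk].
apply: (le_trans (le_normr_Rintegral measurableT fki)).
apply: (@le_trans _ _ (\int[mu]_y g y)).
  apply: le_Rintegral => //; exact: integrable_norm fki.
rewrite /g RintegralZl // {1}/Rintegral cauchy_density_integral //=.
by rewrite mulrAC.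
Qed.

End fejer_norm.

(** * A spectral window with a hole at low frequencies *)
Section trapezoid.
Context {R : realType}.
Implicit Types (b w H B : R).

Definition triangle b w : R := (1 - w / b) * \1_`[0, b] w.

(** Each triangle has a Fejer kernel as cosine transform.  The four coefficients
    are chosen to cancel the constant and the linear parts on [0, H / 2], where
    the limit at infinity gives no information on the spectral density, while the
    combination stays nonnegative and equals 1 on [H, B]. *)
Definition trapezoid H B w : R :=
  2 * triangle (2 * B) w - triangle B w - 2 * triangle H w + triangle (H / 2) w.

Lemma triangleE b w : triangle b w = if (0 <= w) && (w <= b) then 1 - w / b else 0.
Proof.
rewrite /triangle indicE mem_setE in_itv /=.
by case: ifP => _; rewrite ?mulr1 ?mulr0.
Qed.

Lemma trapezoid_hole H B w : 0 < H -> H <= B -> w < H / 2 -> trapezoid H B w = 0.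
Proof.
move=> H0 HB wH; have B0 : 0 < B by exact: lt_le_trans HB.
rewrite /trapezoid !triangleE; have [w0|w0] := leP 0 w => /=; last by rewrite !mulr0; ring.
have -> : w <= 2 * B by lra.
have -> : w <= B by lra.
have -> : w <= H by lra.
have -> : w <= H / 2 by lra.
by field; rewrite !lt0r_neq0.
Qed.

Lemma trapezoid_plateau H B w : 0 < H -> H <= w <= B -> trapezoid H B w = 1.
Proof.
move=> H0 /andP[Hw wB]; have B0 : 0 < B by lra.
rewrite /trapezoid !triangleE.
have -> : 0 <= w by lra.
have -> : w <= 2 * B by lra.
have -> : (w <= H / 2) = false by apply/negbTE; rewrite -ltNge; lra.
rewrite wB /=; case: ifP => [wH|_]; last by field; rewrite lt0r_neq0.
have -> : w = H by lra.
by field; rewrite !lt0r_neq0.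
Qed.

Lemma trapezoid_ge0 H B w : 0 < H -> H <= B -> 0 <= trapezoid H B w.
Proof.
move=> H0 HB; have B0 : 0 < B by exact: lt_le_trans HB.
have [wH2|Hw2] := ltP w (H / 2); first by rewrite trapezoid_hole.
have [wB|Bw] := leP w B; last first.
  rewrite /trapezoid !triangleE.
  have -> : 0 <= w by lra.
  have -> : (w <= H / 2) = false by apply/negbTE; rewrite -ltNge; lra.
  have -> : (w <= H) = false by apply/negbTE; rewrite -ltNge; lra.
  have -> : (w <= B) = false by apply/negbTE; rewrite -ltNge; lra.
  case: ifP => /= [w2B|_]; last by lra.
  have : w / (2 * B) <= 1 by rewrite ler_pdivrMr ?mul1r ?mulr_gt0.
  by lra.
have [Hw|wH] := leP H w; first by rewrite trapezoid_plateau ?Hw.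
rewrite /trapezoid !triangleE wB (ltW wH).
have -> : 0 <= w by lra.
have -> : w <= 2 * B by lra.
have pB : w / (2 * B) = w / B / 2 by field; rewrite lt0r_neq0.
have pH : w / (H / 2) = 2 * (w / H) by field; rewrite lt0r_neq0.
have h1 : 1 <= 2 * (w / H) by rewrite mulrA ler_pdivlMr // mul1r; lra.
have h2 : w / H <= 1 by rewrite ler_pdivrMr // mul1r ltW.
by rewrite pB pH; case: ifP => _ /=; lra.
Qed.

End trapezoid.

(** * Spectral lower bound for the covariance form *)
Section spectral_form.
Context {R : realType}.
Local Notation mu := (@lebesgue_measure R).
Variables (K : R -> R) (n : nat) (x u : 'I_n -> R).
Hypothesis K_cov : covariance_function K.
Hypothesis K_int : mu.-integrable setT (EFin \o K).

Let E (w : R) := \sum_(i < n) \sum_(j < n) u i * u j * cos (w * (x i - x j)).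
Let Emax : R := \sum_(i < n) \sum_(j < n) `|u i * u j|.

Let tri (b w : R) : R := triangle b w.

Let mK : measurable_fun setT K.
Proof. by case/integrableP: K_int => /measurable_EFinP. Qed.

Let measurable_cos_scale (c : R) : measurable_fun setT (fun w : R => cos (w * c)).
Proof.
apply: continuous_measurable_fun.
have -> : (fun w : R => cos (w * c)) = (fun w => cos (c * w)).
  by apply/funext => z; rewrite mulrC.
exact: continuous_cos_scale.
Qed.

Let mE : measurable_fun setT E.
Proof.
apply: measurable_sum => i; apply: measurable_sum => j.
by apply: measurable_funM; [exact: measurable_cst|exact: measurable_cos_scale].
Qed.

Let Emax_ge0 : 0 <= Emax.
Proof. by apply: sumr_ge0 => i _; apply: sumr_ge0 => j _. Qed.

Let E_le w : `|E w| <= Emax.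
Proof.
rewrite (le_trans (ler_norm_sum _ _ _)) //; apply: ler_sum => i _.
rewrite (le_trans (ler_norm_sum _ _ _)) //; apply: ler_sum => j _.
by rewrite normrM ler_piMr // cos_max.
Qed.

Let mtri b : measurable_fun setT (tri b).
Proof.
rewrite /tri /triangle; apply: measurable_funM; last exact: measurable_indic.
apply: measurable_funB; first exact: measurable_cst.
by apply: measurable_funM; [exact: measurable_id|exact: measurable_cst].
Qed.

Let tri_le b w : 0 < b -> `|tri b w| <= \1_`[0, b] w.
Proof.
move=> b0; rewrite /tri /triangle indicE; case: (boolP (w \in _)) => [|_]; last by rewrite mulr0 normr0.
rewrite inE /= in_itv /= mulr1 => /andP[w0 wb].
have : w / b <= 1 by rewrite ler_pdivrMr // mul1r.
have : 0 <= w / b by rewrite divr_ge0 // ltW.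
by move=> ? ?; rewrite ger0_norm; lra.
Qed.

(** Of the two iterated integrals, one is the windowed spectral form, the other
    pairs a Fejer kernel with K and, after translations, with the covariance
    form. *)
Let ker b (z : measurableTypeR R * measurableTypeR R) : R :=
  tri b z.1 * E z.1 * (K z.2 * cos (z.1 * z.2)).

Let mker b : measurable_fun setT (ker b).
Proof.
apply: measurable_funM.
  apply: (measurableT_comp (f := fun w => tri b w * E w)); last exact: measurable_fst.
  by apply: measurable_funM; [exact: mtri|exact: mE].
apply: measurable_funM; first by apply: measurableT_comp; [exact: mK|exact: measurable_snd].
apply: (measurableT_comp (f := @cos R)).
  by apply: continuous_measurable_fun; exact: continuous_cos.
by apply: measurable_funM; [exact: measurable_fst|exact: measurable_snd].
Qed.

Let ker_le b w y : 0 < b -> `|ker b (w, y)| <= \1_`[0, b] w * (Emax * `|K y|).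
Proof.
move=> b0; rewrite /ker /= (normrM (tri b w * E w)) (normrM (tri b w)) (normrM (K y)) -mulrA; apply: ler_pM; rewrite ?mulr_ge0 ?tri_le //.
apply: ler_pM; rewrite ?mulr_ge0 ?E_le //.
by rewrite ler_piMr // cos_max.
Qed.

Let normK_int c : mu.-integrable setT (EFin \o (fun y => c * `|K y|)).
Proof.
have /= := integrableZl measurableT c (integrable_norm K_int).
by congr (mu.-integrable _ _); apply/funext => y; rewrite /= EFinM.
Qed.

Let ker_int b : 0 < b -> (mu \x mu)%E.-integrable setT (EFin \o ker b).
Proof.
move=> b0; apply/integrable12ltyP; first by apply/measurable_EFinP; exact: mker.
pose M := \int[mu]_y (Emax * `|K y|).
apply: (@le_lt_trans _ _ (\int[mu]_w (M * \1_`[0, b] w)%:E)%E); last first.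
  by apply: integral_fune_lt_pinfty => //; exact: integrable_indic_itv.
have M0 : 0 <= M by apply: Rintegral_ge0 => y _; rewrite mulr_ge0.
apply: ge0_le_integral => //.
- by move=> w _; exact: integral_ge0.
- apply: (measurable_fun_fubini_tonelli_F (m2 := mu) (fun z => `|(ker b z)%:E|%E)).
  + by apply/measurable_EFinP; apply: measurableT_comp => //; exact: mker.
  + by move=> z; exact: abse_ge0.
- by case/integrableP: (integrable_indic_itv 0 b M).
- move=> w _; apply: (@le_trans _ _ (\int[mu]_y (\1_`[0, b] w * (Emax * `|K y|))%:E)%E).
    apply: ge0_le_integral => //.
    + have mw : measurable_fun setT (fun y => ker b (w, y)).
        by apply: (measurableT_comp (mker b)); exact: measurable_pair1.
      by apply/measurable_EFinP; apply: measurableT_comp.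
    + apply/measurable_EFinP; apply: measurable_funM; first exact: measurable_cst.
      by case/integrableP: (normK_int Emax) => /measurable_EFinP.
    + by move=> y _; rewrite lee_fin ker_le.
  under eq_integral do rewrite EFinM.
  rewrite integralZl //; last exact: normK_int.
  rewrite mulrC EFinM /M /Rintegral fineK //; exact: integrable_fin_num (normK_int _).
Qed.

Let kerw_int b w : 0 < b -> mu.-integrable setT (fun y => (ker b (w, y))%:E).
Proof.
move=> b0; apply: (integrable_le (g := fun y => \1_`[0, b] w * Emax * `|K y|)).
- by apply: (measurableT_comp (mker b)); exact: measurable_pair1.
- exact: normK_int.
- by move=> y; rewrite -mulrA; exact: ker_le.
Qed.

Let kery_int b y : 0 < b -> mu.-integrable setT (fun w => (ker b (w, y))%:E).
Proof.
move=> b0; apply: (integrable_le (g := fun w => (Emax * `|K y|) * \1_`[0, b] w)).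
- by apply: (measurableT_comp (mker b)); exact: measurable_pair2.
- exact: integrable_indic_itv.
- by move=> w; rewrite [leRHS]mulrC; exact: ker_le.
Qed.

(** The companion sine sum vanishes by antisymmetry in (i, j), so the product
    of cosines can be completed into a cosine of a difference. *)
Lemma cos_form_shift w y : E w * cos (w * y) =
  \sum_(i < n) \sum_(j < n) u i * u j * cos (w * (y - (x i - x j))).
Proof.
have S0 : \sum_(i < n) \sum_(j < n) u i * u j * sin (w * (x i - x j)) = 0.
  set s := LHS; suff : s = - s by lra.
  rewrite {1}/s exchange_big -sumrN; apply: eq_bigr => i _; rewrite -sumrN.
  apply: eq_bigr => j _; rewrite -mulrN -sinN [u j * _]mulrC; congr (_ * sin _); ring.
transitivity (E w * cos (w * y) +
    (\sum_(i < n) \sum_(j < n) u i * u j * sin (w * (x i - x j))) * sin (w * y)).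
  by rewrite S0 mul0r addr0.
rewrite /E !mulr_suml -big_split /=; apply: eq_bigr => i _.
rewrite !mulr_suml -big_split /=; apply: eq_bigr => j _.
by rewrite [w * (y - _)]mulrBr [cos (w * y - _)]cosB; ring.
Qed.

Let form b := \int[mu]_w (tri b w * (spectral_density K w * E w)).

Let inner_w b w : \int[mu]_y ker b (w, y) = tri b w * (spectral_density K w * E w).
Proof.
rewrite /ker /= RintegralZl //; first by rewrite /spectral_density -mulrA [E w * _]mulrC.
apply: (integrable_le (g := fun y => 1 * `|K y|)); last 2 first.
- exact: normK_int.
- by move=> y; rewrite normrM mul1r ler_piMr // cos_max.
apply: measurable_funM; first exact: mK.
under eq_fun do rewrite mulrC.
exact: measurable_cos_scale.
Qed.

Let inner_y b y : 0 < b -> \int[mu]_w ker b (w, y) =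
  \sum_(i < n) \sum_(j < n) u i * u j * (fejer b (y - (x i - x j)) * K y).
Proof.
move=> b0; transitivity (\int[mu]_(w in `[0, b])
    \sum_(i < n) \sum_(j < n) (u i * u j * K y) * ((1 - w / b) * cos (w * (y - (x i - x j))))).
  rewrite [RHS]Rintegral_mkcond; apply: eq_Rintegral => w _.
  rewrite /ker /tri /triangle /patch indicE /=; case: ifP => _; last by rewrite mulr0 !mul0r.
  have -> : (1 - w / b) * 1 * E w * (K y * cos (w * y)) =
    ((1 - w / b) * K y) * (E w * cos (w * y)) by ring.
  rewrite cos_form_shift mulr_sumr; apply: eq_bigr => i _.
  by rewrite mulr_sumr; apply: eq_bigr => j _; ring.
have cf (c d : R) : continuous (fun w : R => c * ((1 - w / b) * cos (w * d))).
  by move=> w; apply: cvgM; [exact: cvg_cst|exact: fejer_integrand_continuous].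
rewrite Rintegral_sum_itv; last by move=> i; apply: continuous_sum => j; exact: cf.
apply: eq_bigr => i _; rewrite Rintegral_sum_itv; last by move=> j; exact: cf.
apply: eq_bigr => j _; rewrite Rintegral_itvZl; last exact: fejer_integrand_continuous.
by rewrite -/(fejer b _) mulrAC -mulrA.
Qed.

Let fejer_K_int (b c : R) : 0 < b ->
  mu.-integrable setT (EFin \o (fun y => fejer b y * K (y + c))).
Proof.
move=> b0; have Kc := integrable_translate c K_int.
apply: (integrable_le (g := fun y => 3 * b * `|K (y + c)|)).
- apply: measurable_funM; first exact: measurable_fejer.
  by case/integrableP: Kc => /measurable_EFinP.
- have /= := integrableZl measurableT (3 * b) (integrable_norm Kc).
  by congr (mu.-integrable _ _); apply/funext => y; rewrite /= EFinM.
- by move=> y; rewrite normrM ler_wpM2r // fejer_bound.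
Qed.

(** The windowed spectral form equals the integral of the Fejer kernel against
    the covariance form, by Fubini and translation of each term; then
    cov_form_max and the uniform L1 bound apply. *)
Let form_fejer (b : R) : 0 < b ->
  mu.-integrable setT (EFin \o (fun w => tri b w * (spectral_density K w * E w))) /\
  `|form b| <= 3 * pi * cov_form K x u 0.
Proof.
move=> b0; have [i1 i2] := Rintegral_fubini (ker_int b0) (fun w => kerw_int w b0) (fun y => kery_int y b0).
split.
  by move: i1; congr (mu.-integrable _ _); apply/funext => w /=; rewrite inner_w.
have -> : form b = \int[mu]_y (fejer b y * cov_form K x u y).
  rewrite /form; under eq_Rintegral do rewrite -inner_w.
  rewrite i2; under eq_Rintegral do rewrite inner_y //.
  have A c d : mu.-integrable setT (EFin \o (fun y => c * (fejer b (y - d) * K y))).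
    have := integrable_translate (- d) (fejer_K_int d b0) => /= h.
    have := integrableZl measurableT c h; congr (mu.-integrable _ _).
    by apply/funext => y /=; rewrite -EFinM subrK.
  have A' c d : mu.-integrable setT (EFin \o (fun y => c * (fejer b y * K (y + d)))).
    have := integrableZl measurableT c (fejer_K_int d b0); congr (mu.-integrable _ _).
  have -> : \int[mu]_y (fejer b y * cov_form K x u y) =
    \int[mu]_y (\sum_(i < n) \sum_(j < n) u i * u j * (fejer b y * K (y + (x i - x j)))).
    apply: eq_Rintegral => y _; rewrite /cov_form mulr_sumr; apply: eq_bigr => i _.
    by rewrite mulr_sumr; apply: eq_bigr => j _; rewrite [y + _]addrC; ring.
  have sumA i := Rintegral_sum (P := mu) measurableT (fun j => A (u i * u j) (x i - x j)).
  have sumA' i := Rintegral_sum (P := mu) measurableT (fun j => A' (u i * u j) (x i - x j)).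
  rewrite (Rintegral_sum (P := mu) measurableT (fun i => (sumA i).1)).2 (Rintegral_sum (P := mu) measurableT (fun i => (sumA' i).1)).2.
  apply: eq_bigr => i _; rewrite (sumA i).2 (sumA' i).2; apply: eq_bigr => j _.
  have := Rintegral_translate (- (x i - x j)) (A' (u i * u j) (x i - x j)) => <-.
  by apply: eq_Rintegral => y _; rewrite subrK.
have covm : measurable_fun setT (cov_form K x u).
  apply: measurable_sum => i; apply: measurable_sum => j.
  apply: measurable_funM; first exact: measurable_cst.
  under eq_fun do rewrite addrC.
  by case/integrableP: (integrable_translate (x i - x j) K_int) => /measurable_EFinP.
by apply: fejer_pairing_le => // y; exact: cov_form_max.
Qed.

(** On [H, B] the trapezoid is 1, and elsewhere its contribution is
    nonnegative; each triangle contributes at most 3 pi times the value of the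
    covariance form at 0, and the weights 2, 1, 2, 1 add up to 6. *)
Lemma spectral_lower_bound (H B : R) (g : R -> R) : 0 < H -> H <= B ->
  continuous g -> (forall w, H / 2 <= w -> 0 <= spectral_density K w) ->
  (forall w, H <= w <= B -> g w <= spectral_density K w *
    \sum_(i < n) \sum_(j < n) u i * u j * cos (w * (x i - x j))) ->
  (forall w, H / 2 <= w -> 0 <= \sum_(i < n) \sum_(j < n) u i * u j * cos (w * (x i - x j))) ->
  \int[mu]_(w in `[H, B]) g w <= 18 * pi * cov_form K x u 0.
Proof.
move=> H0 HB cg S0 gS E0.
have B0 : 0 < B by exact: lt_le_trans HB.
have B20 : 0 < 2 * B by lra.
have H20 : 0 < H / 2 by lra.
have [i1 b1] := form_fejer B20; have [i2 b2] := form_fejer B0.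
have [i3 b3] := form_fejer H0; have [i4 b4] := form_fejer H20.
pose F b w := tri b w * (spectral_density K w * E w).
have iD f1 f2 : mu.-integrable setT (EFin \o f1) -> mu.-integrable setT (EFin \o f2) ->
    mu.-integrable setT (EFin \o (fun w : R => f1 w + f2 w)).
  by move=> h1 h2; have := integrableD measurableT h1 h2; congr (mu.-integrable _ _).
have iZ c f1 : mu.-integrable setT (EFin \o f1) ->
    mu.-integrable setT (EFin \o (fun w : R => c * f1 w)).
  by move=> h1; have := integrableZl measurableT c h1; congr (mu.-integrable _ _).
have -> : \int[mu]_(w in `[H, B]) g w = \int[mu]_w (g \_ `[H, B]) w by rewrite Rintegral_mkcond.
apply: (@le_trans _ _ (\int[mu]_w ((2 * F (2 * B) w + (-1) * F B w) + ((-2) * F H w + F (H / 2) w)))).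
  apply: le_Rintegral => //.
  - have gi := continuous_integrable_itv H B cg.
    have := (integrable_mkcond (mu := mu) (D := `[H, B]%classic) (EFin \o g) (measurable_itv `[H, B])).1 gi.
    congr (mu.-integrable _ _); apply/funext => w; rewrite /patch /=; by case: ifP.
  - by apply: (iD); apply: (iD) => //; apply: (iZ).
  move=> w _; rewrite /patch.
  have -> : 2 * F (2 * B) w + -1 * F B w + (-2 * F H w + F (H / 2) w) =
    trapezoid H B w * (spectral_density K w * E w).
    by rewrite /F /trapezoid /tri; ring.
  case: ifPn; rewrite mem_setE in_itv /= => hw.
    by rewrite trapezoid_plateau // mul1r gS.
  have [wH|Hw] := ltP w (H / 2); first by rewrite trapezoid_hole // mul0r.
  by rewrite !mulr_ge0 ?S0 ?E0 // trapezoid_ge0.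
rewrite RintegralD //; [|by apply: (iD) => //; apply: (iZ)|by apply: (iD) => //; apply: (iZ)].
rewrite RintegralD //; [|exact: iZ|exact: iZ].
rewrite RintegralD //; [|exact: iZ].
rewrite !RintegralZl // -!/(form _).
move: b1 b2 b3 b4; rewrite -mulrA -[18 * pi * _]mulrA !ler_norml.
move: (form (2 * B)) (form B) (form H) (form (H / 2)) (pi * _) => y1 y2 y3 y4 y.
by clear i1 i2 i3 i4 F iD iZ B20 H20 B0 S0 gS E0 cg HB H0 => /andP[? ?] /andP[? ?] /andP[? ?] /andP[? ?]; lra.
Qed.

End spectral_form.

(** * Quadratic bound for the step vector *)
Section detection.
Context {R : realType}.
Local Notation mu := (@lebesgue_measure R).

(** The three ingredients combined: spectral_lower_bound with the weight w^(-2p)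
    replaced by the energy of the window sums, energy_uncertainty for the
    frequencies below H, and step_sqr_le.  The power of n is 2p from the rescaled
    weight (w / n)^(-2p), minus 1 from Parseval. *)
Lemma step_detection_bound (K : R -> R) (p : nat) (C'K : R) :
  covariance_function K -> mu.-integrable setT (EFin \o K) -> (0 < p)%N ->
  0 < C'K -> spectral_density K w * `|w| ^+ (2 * p) @[w --> +oo] --> C'K ->
  exists (C : R) (n0 : nat), [/\ 0 < C, (0 < n0)%N &
    forall (n t : nat) (u : 'I_n -> R), (n0 <= n)%N -> (0 < t <= n)%N ->
      (\sum_(k < n) u k * zeta t k) ^+ 2 <= C * n%:R ^+ (2 * p).-1 *
        \sum_(i < n) \sum_(j < n) u i * u j * K (i.+1%:R / n%:R - j.+1%:R / n%:R)].
Proof.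
move=> K_cov K_int p_gt0 C'0 K_lim.
(* beyond W the spectral density exceeds half of its limiting profile *)
have [W [W0 HW]] : exists W : R, 1 <= W /\ forall w, W <= w ->
    C'K / 2 <= spectral_density K w * w ^+ (2 * p).
  have C20 : 0 < C'K / 2 by rewrite divr_gt0.
  have /cvgrPdist_le /(_ _ C20) [M [Mr HM]] := K_lim.
  exists (Num.max 1 (M + 1)); split; first by rewrite le_max lexx.
  move=> w; rewrite ge_max => /andP[w1 Mw].
  have /HM : M < w by lra.
  have w0 : 0 <= w by lra.
  by rewrite (ger0_norm w0) ler_norml => /andP[]; lra.
pose H := 2 * W; have H0 : 0 < H by rewrite mulr_gt0 //; lra.
have [C1 [n0 [C10 n00 Hunc]]] := @energy_uncertainty R p.+1 H (ltn0Sn p) H0.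
have [ka ka0 kaE] : exists2 ka : R, 0 < ka & ka = cos 1 ^+ 2 / 4.
  by exists (cos 1 ^+ 2 / 4) => //; rewrite divr_gt0 // exprn_gt0 // cos1_gt0.
(* 180 = 10 (step_sqr_le) * 18 (spectral_lower_bound), where the factor 1 / 2 of
   the profile cancels the 2 of Parseval; 16 ^ p = 4 ^ p (step_sqr_le) times
   4 ^ p (energy_window_sum_le) *)
exists (180 * C1 * 16 ^+ p / (C'K * ka ^+ p)), n0; split => //.
  by rewrite divr_gt0 ?mulr_gt0 ?exprn_gt0.
move=> n t u nn0 tn.
have n_gt0 : (0 < n)%N by rewrite (leq_trans _ nn0).
have n_gt0' : 0 < n%:R :> R by rewrite ltr0n.
have n_neq0 := lt0r_neq0 n_gt0'.
pose U : {poly R} := rVpoly (\row_k u k).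
have Uk (k : 'I_n) : U`_k = u k by rewrite coef_rVpoly_ord mxE.
have sU : (size U <= n)%N by exact: size_poly.
pose v := window_sum n p U.
have sv : (size v <= p.+1 * n)%N by exact: size_window_sum.
have [Hb Hunc_v] := Hunc n v nn0 sv; set b := pi * n%:R in Hb Hunc_v.
pose x (i : 'I_n) : R := i.+1%:R / n%:R.
set q := \sum_(i < n) _.
have qE : q = cov_form K x u 0.
  by apply: eq_bigr => i _; apply: eq_bigr => j _; rewrite addr0.
have energyU w : \sum_(i < n) \sum_(j < n) u i * u j * cos (w * (x i - x j)) = energy U (w / n%:R).
  rewrite (energyE _ sU); apply: eq_bigr => i _; apply: eq_bigr => j _.
  rewrite !Uk /x; congr (_ * cos _); rewrite -[i.+1%:R]natr1 -[j.+1%:R]natr1; field.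
  exact: n_neq0.
(* on [H, b] the density times the energy of U is at least c0 times the energy
   of V *)
pose c0 := C'K / 2 * (ka / (4 * n%:R ^+ 2)) ^+ p.
have c00 : 0 < c0.
  apply: mulr_gt0; first exact: divr_gt0.
  by apply: exprn_gt0; rewrite divr_gt0 // mulr_gt0 // exprn_gt0.
have S0 w : H / 2 <= w -> 0 <= spectral_density K w.
  move=> Hw; have wW : W <= w by move: Hw; rewrite /H; lra.
  have w0 : 0 < w by lra.
  have := HW w wW; rewrite -(pmulr_lge0 _ (exprn_gt0 (2 * p) w0)) => h.
  by apply: le_trans h; rewrite divr_ge0 // ltW.
have cE : continuous (fun w : R => c0 * energy v (w / n%:R)).
  by move=> w; apply: cvgM; [exact: cvg_cst|exact: energy_scaled_continuous].
have := spectral_lower_bound (x := x) (u := u) K_cov K_int H0 Hb cE S0.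
rewrite -qE => low.
have {low} : \int[mu]_(w in `[H, b]) (c0 * energy v (w / n%:R)) <= 18 * pi * q.
  apply: low; last by move=> w _; rewrite energyU energy_ge0.
  move=> w /andP[Hw wb]; rewrite energyU.
  have w0 : 0 < w by exact: lt_le_trans Hw.
  have wp : 0 < w ^+ (2 * p) by exact: exprn_gt0.
  have wn : 0 <= w / n%:R <= pi.
    by rewrite divr_ge0 ?(ltW w0) //= ler_pdivrMr.
  have h1 := energy_window_sum_le n p U wn; rewrite -kaE -/v in h1.
  have h2 : C'K / 2 / w ^+ (2 * p) <= spectral_density K w.
    rewrite ler_pdivrMr //; apply: HW; move: Hw; rewrite /H; lra.
  apply: (@le_trans _ _ (C'K / 2 / w ^+ (2 * p) * energy U (w / n%:R))); last first.
    by rewrite ler_wpM2r ?energy_ge0.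
  have -> : c0 * energy v (w / n%:R) = C'K / 2 / w ^+ (2 * p) *
      ((ka * (w / n%:R) ^+ 2) ^+ p * energy v (w / n%:R) / 4 ^+ p).
    rewrite /c0 expr_div_n [(4 * _) ^+ p]exprMn -exprM [(ka * _) ^+ p]exprMn -exprM expr_div_n.
    have nn0' : n%:R ^+ (2 * p) != 0 :> R by rewrite lt0r_neq0 ?exprn_gt0.
    have p40 : (4 : R) ^+ p != 0 by rewrite lt0r_neq0 ?exprn_gt0.
    move: (lt0r_neq0 wp) p40 nn0'; move: (4 ^+ p) (w ^+ (2 * p)) (n%:R ^+ (2 * p)) (ka ^+ p).
    by move=> y1 y2 y3 y4 y20 y10 y30; field; rewrite y10 y20 y30.
  rewrite ler_wpM2l //; first by rewrite !divr_ge0 // ltW.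
  by rewrite ler_pdivrMr ?exprn_gt0 // mulrC [leRHS]mulrC [leLHS]mulrC.
rewrite Rintegral_itvZl; last exact: energy_scaled_continuous.
move: Hunc_v; rewrite (energy_parseval n_gt0 sv).
set I := \int[mu]_(x in _) _; set Q := \sum_(i < _) _ => h1 h2.
have h3 : (\sum_(k < n) u k * zeta t k) ^+ 2 <= 10 * 4 ^+ p * Q.
  under eq_bigr => k _ do rewrite -Uk.
  apply: le_trans (step_sqr_le U tn p_gt0) _; rewrite ler_wpM2l ?mulr_ge0 //.
  rewrite /Q (big_ord_widen (p.+1 * n) (fun i => v`_i ^+ 2)) ?leq_pmull //.
  by rewrite [leLHS]big_mkcond; apply: ler_sum => i _; case: ifP => _ //; rewrite sqr_ge0.
apply: (le_trans h3).
have h4 : Q <= C1 * (18 * pi * q / c0) / (2 * pi * n%:R).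
  rewrite ler_pdivlMr ?mulr_gt0 ?pi_gt0 // mulrC (le_trans h1) // ler_wpM2l ?(ltW C10) //.
  by rewrite ler_pdivlMr // mulrC.
apply: (@le_trans _ _ (10 * 4 ^+ p * (C1 * (18 * pi * q / c0) / (2 * pi * n%:R)))).
  by rewrite ler_wpM2l // mulr_ge0.
rewrite le_eqVlt; apply/orP; left; apply/eqP.
have np : n%:R ^+ (2 * p) = n%:R * n%:R ^+ (2 * p).-1 :> R.
  by rewrite -exprS prednK // muln_gt0.
have -> : c0 = C'K / 2 * (ka ^+ p / (4 ^+ p * (n%:R * n%:R ^+ (2 * p).-1))).
  by rewrite /c0 expr_div_n exprMn -exprM np.
have -> : 16 ^+ p = 4 ^+ p * 4 ^+ p :> R by rewrite -exprMn; congr (_ ^+ _); ring.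
have kap : ka ^+ p != 0 by rewrite lt0r_neq0 ?exprn_gt0.
have nn : n%:R ^+ (2 * p).-1 != 0 :> R by rewrite lt0r_neq0 ?exprn_gt0.
have p4 : (4 : R) ^+ p != 0 by rewrite lt0r_neq0 ?exprn_gt0.
have C'n0 := lt0r_neq0 C'0; have pin0 := lt0r_neq0 (pi_gt0 R).
move: (ka ^+ p) (n%:R ^+ (2 * p).-1) (4 ^+ p) kap nn p4 => y1 y2 y3 y10 y20 y30.
move: pin0; move: (@pi R) => y4 y40.
by field; rewrite y10 y20 y30 y40 C'n0 n_neq0.
Qed.

End detection.

(** * Moment generating function of a Gaussian law *)
Section gaussian_mgf.
Context {R : realType}.
Local Notation mu := (@lebesgue_measure R).

Lemma ge0_integral_normal_prob (m s : R) (f : measurableTypeR R -> \bar R) :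
  s != 0 -> measurable_fun setT f -> (forall x, (0 <= f x)%E) ->
  (\int[normal_prob m s]_x f x = \int[mu]_x (f x * (normal_pdf m s x)%:E))%E.
Proof.
move=> s0 mf f0.
have dom := normal_prob_dominates m s.
rewrite -(Radon_Nikodym_SigmaFinite.change_of_variables dom) //.
apply: ae_eq_integral => //.
- apply: emeasurable_funM => //; apply: measurable_int.
  exact: Radon_Nikodym_SigmaFinite.f_integrable.
- by apply: emeasurable_funM => //; apply/measurable_EFinP; exact: measurable_normal_pdf.
- apply: ae_eqe_mul2l; apply: integral_ae_eq => //.
  + exact: Radon_Nikodym_SigmaFinite.f_integrable.
  + by apply/measurable_EFinP; exact: measurable_normal_pdf.
  + by move=> E _ mE; rewrite -Radon_Nikodym_SigmaFinite.f_integral.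
Qed.

(** Completing the square: an exponential tilt translates a Gaussian density. *)
Lemma normal_pdf_tilt (m s l x : R) : s != 0 ->
  expR (l * x) * normal_pdf m s x =
  expR (l * m + l ^+ 2 * s ^+ 2 / 2) * normal_pdf (m + l * s ^+ 2) s x.
Proof.
move=> s0; rewrite !normal_pdfE // /normal_fun mulrCA [RHS]mulrCA -!expRD.
congr (_ * expR _); rewrite -[s ^+ 2 *+ 2]mulr_natr; field.
by rewrite s0.
Qed.

Lemma measurable_expR_scale (l : R) :
  measurable_fun setT (fun x : measurableTypeR R => (expR (l * x))%:E).
Proof.
apply/measurable_EFinP; apply: continuous_measurable_fun => x.
apply: (@continuous_comp _ _ _ (fun x => l * x) (@expR R)); last exact: continuous_expR.
by apply: cvgM; [exact: cvg_cst|exact: cvg_id].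
Qed.

Lemma normal_mgf (m s l : R) : s != 0 ->
  (\int[normal_prob m s]_x (expR (l * x))%:E = (expR (l * m + l ^+ 2 * s ^+ 2 / 2))%:E)%E.
Proof.
move=> s0; rewrite (ge0_integral_normal_prob m s0 (measurable_expR_scale l)); last first.
  by move=> x; rewrite lee_fin expR_ge0.
under eq_integral do rewrite -EFinM normal_pdf_tilt // EFinM.
rewrite ge0_integralZl //.
- by rewrite integral_normal_pdf mule1.
- by apply/measurable_EFinP; exact: measurable_normal_pdf.
- by move=> x _; rewrite lee_fin normal_pdf_ge0.
Qed.

(** Point masses, which occur for degenerate linear combinations, obey the
    formula with s = 0. *)
Lemma gaussian_law_mgf {d} {Om : measurableType d} (P : probability Om R)
    (Z : Om -> R) (m s l : R) : measurable_fun setT Z ->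
  (forall A : set (measurableTypeR R), measurable A -> P (Z @^-1` A) = gaussian_law m s A) ->
  (\int[P]_w (expR (l * Z w))%:E = (expR (l * m + l ^+ 2 * s ^+ 2 / 2))%:E)%E.
Proof.
move=> mZ lawZ.
have := @ge0_integral_pushforward _ _ Om (measurableTypeR R) R Z mZ P setT
  (fun x => (expR (l * x))%:E) measurableT (measurable_expR_scale l).
move=> <-; last by move=> x _; rewrite lee_fin expR_ge0.
have [s0|s0] := eqVneq s 0.
  transitivity (\int[\d_(m : measurableTypeR R)]_x (expR (l * x))%:E)%E.
    apply: eq_measure_integral => A mA _.
    by rewrite -[LHS]/(P (Z @^-1` A)) lawZ // /gaussian_law s0 eqxx.
  rewrite integral_dirac //=; last exact: measurable_expR_scale.
  by rewrite diracT mul1e s0 expr0n /= mulr0 mul0r addr0.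
rewrite -normal_mgf //; apply: eq_measure_integral => A mA _.
by rewrite -[LHS]/(P (Z @^-1` A)) lawZ // /gaussian_law (negbTE s0).
Qed.

End gaussian_mgf.

(** * Dominated limits and classes of indicators *)
Section dominated.
Context {R : realType} {d : measure_display} {T : measurableType d}.
Variable P : {measure set T -> \bar R}.

Lemma Rintegral_dominated_cvg (f_ : (T -> R)^nat) (f h : T -> R) :
  (forall k, measurable_fun setT (f_ k)) ->
  (forall x, f_ ^~ x @ \oo --> f x) ->
  P.-integrable setT (EFin \o h) ->
  (forall k x, `|f_ k x| <= h x) ->
  P.-integrable setT (EFin \o f) /\
  \int[P]_x f_ k x @[k --> \oo] --> \int[P]_x f x.
Proof.
move=> mf ff hi fh.
have mlim : measurable_fun setT f by apply: (measurable_fun_cvg mf) => x _; exact: ff.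
have [||||i1 _ i2] := @dominated_convergence _ T R P setT measurableT
    (fun k => EFin \o f_ k) (EFin \o f) (EFin \o h) _ _ _ hi.
- by move=> k; exact/measurable_EFinP.
- exact/measurable_EFinP.
- by apply: aeW => x _ /=; apply: cvg_EFin; [exact: nearW|exact: ff].
- by apply: aeW => x k _ /=; rewrite lee_fin.
split => //; apply: fine_cvg.
by rewrite /Rintegral fineK //; exact: integrable_fin_num.
Qed.

End dominated.

Section indic_dynkin.
Context {R : realType} {d : measure_display} {T : measurableType d}.

(** A pi-lambda argument for classes of functions: a class which is closed under
    sums, differences and uniformly bounded limits contains all measurable
    indicators once it contains those of a generating pi-system.  Countable
    disjoint unions are limits of partial sums of indicators, which stay below 1
    by disjointness. *)
Lemma indic_dynkin (C : (T -> R) -> Prop) (G : set (set T)) :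
  @measurable _ T = <<s G >> -> setI_closed G ->
  C (cst 1) ->
  (forall f g, C f -> C g -> C (fun x => f x + g x)) ->
  (forall f g, C f -> C g -> C (fun x => f x - g x)) ->
  (forall (f_ : (T -> R)^nat) f, (forall k, C (f_ k)) -> (forall k x, `|f_ k x| <= 1) ->
    (forall x, f_ ^~ x @ \oo --> f x) -> C f) ->
  (forall A, G A -> C (\1_A)) ->
  forall A, measurable A -> C (\1_A).
Proof.
move=> GE GI C1 CD CB Clim CG.
suff H : forall A, <<s G >> A -> C (\1_A) by move=> A; rewrite GE; exact: H.
apply: dynkin_induction => //.
- have -> : (\1_[set: T] : T -> R) = cst 1 by apply/funext => x; rewrite indicT.
  exact: C1.
- move=> S _ CS; have -> : (\1_(~` S) : T -> R) = fun x => cst 1 x - \1_S x.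
    by apply/funext => x; rewrite !indicE in_setC /=; case: (x \in S); rewrite ?subrr ?subr0.
  exact: CB.
- move=> F mF tF CF.
  have C0 : C (fun x => 0).
    by have := CB _ _ C1 C1; congr C; apply/funext => x; rewrite subrr.
  pose s k x : R := \sum_(i < k) \1_(F i) x.
  have sE k x (i : nat) : F i x -> s k x = (i < k)%:R.
    move=> Fix; have E (j : nat) : \1_(F j) x = (j == i)%:R :> R.
      rewrite indicE; case: (eqVneq j i) => [->|ji]; first by rewrite mem_set.
      case: (boolP (x \in F j)) => // /set_mem Fjx.
      by move: ji; rewrite (tF j i I I) ?eqxx //; exists x.
    rewrite /s; under eq_bigr do rewrite E.
    have [ik|ki] := ltnP i k.
      by rewrite (bigD1 (Ordinal ik)) //= eqxx big1 ?addr0 // => j /eqP ji;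
        case: eqP => // e; case: ji; exact/val_inj.
    by rewrite big1 // => j _; case: eqP => // e; move: (ltn_ord j); rewrite e ltnNge ki.
  have s0 k x : ~ (\bigcup_i F i) x -> s k x = 0.
    move=> nFx; rewrite /s big1 // => i _; rewrite indicE memNset // => Fix; apply: nFx.
    by exists i.
  apply: (Clim s).
  + elim=> [|k IH]; first by move: C0; congr C; apply/funext => x; rewrite /s big_ord0.
    have := CD _ _ IH (CF k); congr C; apply/funext => x.
    by rewrite /s big_ord_recr.
  + move=> k x; case: (pselect ((\bigcup_i F i) x)) => [[i _ /sE ->]|/s0 ->].
      by case: ltnP; rewrite ?normr1 ?normr0.
    by rewrite normr0.
  + move=> x; case: (pselect ((\bigcup_i F i) x)) => [Fx|nFx].
      rewrite indicE mem_set //; case: Fx => i _ Fix.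
      apply: cvg_near_cst; exists i.+1 => // k /= ik.
      by rewrite (sE _ _ _ Fix) ik.
    rewrite indicE memNset //; apply: cvg_near_cst.
    by apply: nearW => k; exact: s0.
Qed.

End indic_dynkin.

(** * Exponential bounds and approximation of the sign *)
Section exponential_bounds.
Context {R : realType}.
Implicit Types x y : R.

Lemma expR_norm_le x : expR `|x| <= expR x + expR (- x).
Proof.
have [x0|x0] := ger0P x; first by rewrite lerDl expR_ge0.
by rewrite lerDr expR_ge0.
Qed.

Lemma norm_le_expR x : `|x| <= expR `|x|.
Proof. by have := expR_ge1Dx `|x|; lra. Qed.

(** Both signs follow from 1 + x <= exp x applied to x and - x. *)
Lemma expR_sub1_le x : `|expR x - 1| <= `|x| * expR `|x|.
Proof.
have h1 := expR_ge1Dx x; have h2 := expR_ge1Dx (- x).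
have e0 := expR_gt0 x; have eN : expR x * expR (- x) = 1 by rewrite -expRD subrr expR0.
have [x0|x0] := ger0P x.
  rewrite ger0_norm; last by lra.
  have : expR x * (1 - x) <= 1 by rewrite -eN ler_pM2l //; lra.
  lra.
rewrite ler0_norm; last by rewrite subr_le0 -expR0 ler_expR ltW.
have : 1 <= expR (- x) by rewrite -expR0 ler_expR; lra.
by move=> h; nra.
Qed.

(** An exponential bound uniform in the step h, which dominates the difference
    quotients in integrals. *)
Lemma diff_quotient_expR_le (h x : R) : 0 < h <= 1 ->
  `|(expR (h * x) - 1) / h| <= expR (2 * x) + expR (- (2 * x)).
Proof.
move=> /andP[h0 h1]; apply: le_trans (expR_norm_le (2 * x)).
rewrite normrM [`|_^-1|]ger0_norm ?invr_ge0 ?(ltW h0) // ler_pdivrMr //.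
apply: (le_trans (expR_sub1_le _)).
have -> : `|h * x| = h * `|x| by rewrite normrM (ger0_norm (ltW h0)).
have -> : `|2 * x| = `|x| + `|x| by rewrite normrM ger0_norm //; ring.
rewrite expRD [leLHS](_ : _ = h * (`|x| * expR (h * `|x|))); last by ring.
rewrite [leRHS]mulrC ler_pM2l //.
by apply: ler_pM; rewrite ?expR_ge0 ?norm_le_expR // ler_expR ler_piMl.
Qed.

Lemma diff_quotient_expR_cvg (h_ : R^nat) x :
  (forall k, 0 < h_ k <= 1) -> h_ @ \oo --> (0 : R) ->
  (expR (h_ k * x) - 1) / h_ k @[k --> \oo] --> x.
Proof.
move=> h01 hcvg.
have H (k : nat) : `|x - (expR (h_ k * x) - 1) / h_ k| <=
   `|x| * (expR `|x| * `|x|) * h_ k.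
  have /andP[] := h01 k; set h := h_ k => h0 h1.
  have a1 := expR_ge1Dx (h * x); have a2 := expR_ge1Dx (- (h * x)).
  have e0 := expR_gt0 (h * x).
  have eN : expR (h * x) * expR (- (h * x)) = 1 by rewrite -expRD subrr expR0.
  have up : expR (h * x) - 1 <= h * x * expR (h * x).
    have : expR (h * x) * (1 - h * x) <= 1 by rewrite -eN ler_pM2l //; lra.
    lra.
  have q1 : x <= (expR (h * x) - 1) / h by rewrite ler_pdivlMr // mulrC; lra.
  have q2 : (expR (h * x) - 1) / h <= x * expR (h * x).
    by rewrite ler_pdivrMr // mulrAC [x * h]mulrC.
  rewrite distrC ger0_norm ?subr_ge0 //.
  apply: (@le_trans _ _ (x * (expR (h * x) - 1))); first lra.
  apply: (le_trans (ler_norm _)); rewrite normrM -!mulrA ler_wpM2l //.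
  apply: (le_trans (expR_sub1_le _)); rewrite normrM (ger0_norm (ltW h0)).
  rewrite [leLHS](_ : _ = (h * `|x|) * expR (h * `|x|)); last by ring.
  rewrite [leRHS](_ : _ = (h * `|x|) * expR `|x|); last by ring.
  rewrite ler_wpM2l ?mulr_ge0 ?(ltW h0) // ler_expR.
  by rewrite ler_piMl.
apply/cvgrPdist_le => e e0.
move: H; set c := `|x| * _ => H.
have c0 : 0 <= c by rewrite !mulr_ge0 ?expR_ge0.
have ec : 0 < e / (c + 1) by rewrite divr_gt0 //; lra.
move/cvgrPdist_lt : hcvg => /(_ _ ec).
apply: filterS => k; rewrite sub0r normrN; have /andP[hk0 _] := h01 k.
rewrite (ger0_norm (ltW hk0)) => hk.
apply: (le_trans (H k)); rewrite (@le_trans _ _ (c * (e / (c + 1)))) //.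
  by rewrite ler_wpM2l // ltW.
by rewrite mulrA ler_pdivrMr; [nra|lra].
Qed.

(** The Taylor sums of the sine are dominated termwise by the exponential
    series at |x|, uniformly in the order. *)
Lemma norm_series_sin_coeff_le x k : `|series (sin_coeff x) k| <= expR `|x|.
Proof.
apply: (@le_trans _ _ (series (exp_coeff `|x|) k)).
  rewrite /series /= (le_trans (ler_norm_sum _ _ _)) //; apply: ler_sum => i _.
  rewrite /exp_coeff /sin_coeff /= !normrM normfV !normr_nat !normrX normrN normr1 expr1n mulr1.
  by case: odd; [rewrite mul1r| rewrite !mul0r].
rewrite /expR; apply: nondecreasing_cvgn_le; last exact: is_cvg_series_exp_coeff.
by apply: nondecreasing_series => i _ _; exact: exp_coeff_ge0.
Qed.

Lemma cvg_series_sin_coeff x : series (sin_coeff x) @ \oo --> sin x.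
Proof. by rewrite unlock; exact: is_cvg_series_sin_coeff. Qed.

(** This cubic maps [-1, 1] into itself with fixed points -1, 0 and 1, of which
    only 0 is repelling; its iterates are polynomials that converge to the sign. *)
Definition sign_step x := (3 * x - x ^+ 3) / 2.

Lemma sign_step_iter_le (x : R) k : `|x| <= 1 -> `|iter k sign_step x| <= 1.
Proof.
move=> x1; elim: k => //= k; move: (iter k _ _) => y.
rewrite /sign_step !ler_norml => /andP[y1 y2].
have h1 : 0 <= (1 - y) ^+ 2 * (2 + y) by rewrite mulr_ge0 ?sqr_ge0 //; lra.
have h2 : 0 <= (1 + y) ^+ 2 * (2 - y) by rewrite mulr_ge0 ?sqr_ge0 //; lra.
by apply/andP; split; lra.
Qed.

Lemma sign_step_iter_cvg (x : R) : `|x| <= 1 -> iter k sign_step x @[k --> \oo] --> Num.sg x.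
Proof.
have pos y : 0 < y -> y <= 1 -> iter k sign_step y @[k --> \oo] --> (1 : R).
  move=> y0 y1.
  have st z : y <= z <= 1 -> z <= sign_step z <= 1.
    move=> /andP[yz z1]; rewrite /sign_step.
    have h1 : 0 <= (1 - z) ^+ 2 * (2 + z) by rewrite mulr_ge0 ?sqr_ge0 //; lra.
    have h2 : 0 <= z * ((1 - z) * (1 + z)) by rewrite !mulr_ge0 //; lra.
    by apply/andP; split; lra.
  have b k : y <= iter k sign_step y <= 1.
    elim: k => [|k /= IH]; first by rewrite /= lexx.
    have /andP[a1 ->] := st _ IH; rewrite andbT.
    by case/andP: IH => yi _; exact: le_trans a1.
  (* on [y, 1] the distance to the fixed point 1 shrinks by 1 - y / 2 at least *)
  have q k : 1 - iter k sign_step y <= (1 - y / 2) ^+ k.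
    elim: k => [|k IH]; first by rewrite expr0 /=; lra.
    rewrite exprS; apply: (@le_trans _ _ ((1 - y / 2) * (1 - iter k sign_step y))).
      have /andP[] := b k; rewrite iterS /sign_step; move: (iter k _ _) => t yt t1.
      have h : 0 <= (1 - t) * ((t - y) + t ^+ 2).
        by apply: mulr_ge0; [lra|have := sqr_ge0 t; lra].
      lra.
    by rewrite ler_wpM2l //; lra.
  apply/cvgrPdist_le => e e0.
  have r1 : `|1 - y / 2| < 1 by rewrite ger0_norm; lra.
  have /cvgrPdist_le /(_ _ e0) := cvg_expr r1.
  apply: filterS => k; rewrite sub0r normrN ger0_norm; last by rewrite exprn_ge0 //; lra.
  have /andP[_ b1] := b k.
  by rewrite ger0_norm ?subr_ge0 //; apply: le_trans.
have sN z : sign_step (- z) = - sign_step z by rewrite /sign_step; field.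
have iN k z : iter k sign_step (- z) = - iter k sign_step z.
  by elim: k => //= k ->; rewrite sN.
rewrite ler_norml => /andP[x1 x2]; have [x0|x0|->] := ltrgt0P x.
- by rewrite gtr0_sg //; exact: pos.
- rewrite ltr0_sg //.
  have -> : (fun k => iter k sign_step x) = (fun k => - iter k sign_step (- x)).
    by apply/funext => k; rewrite iN opprK.
  by apply: cvgN; apply: pos; lra.
- rewrite sgr0; have -> : (fun k => iter k sign_step (0 : R)) = cst 0; last exact: cvg_cst.
  by apply/funext => k; elim: k => //= k ->; rewrite /sign_step expr0n mulr0 subr0 mul0r.
Qed.

(** For |x| < k + 1 the argument lies in (-pi, pi), where the sine has the sign
    of its argument: dilating the sine turns it into a bounded function with the
    right sign on any given bounded set. *)
Lemma sign_sin_cvg (x : R) : Num.sg (sin (k.+1%:R^-1 * x)) @[k --> \oo] --> Num.sg x.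
Proof.
apply: cvg_near_cst; exists (Num.truncn `|x|).+1 => // k /= xk.
have kx : `|x| < k.+1%:R.
  by apply: (lt_le_trans (truncnS_gt _)); rewrite ler_nat; apply: leqW.
have pos (y : R) : 0 < y -> y < k.+1%:R -> 0 < sin (k.+1%:R^-1 * y).
  move=> y0 yk; apply: sin_gt0_pi; rewrite mulr_gt0 ?invr_gt0 //=.
  apply: (@lt_trans _ _ 1); first by rewrite mulrC ltr_pdivrMr ?mul1r.
  by have := pi_ge2 R; lra.
have [x0|x0|->] := ltrgt0P x.
- by rewrite !gtr0_sg // pos // (le_lt_trans (ler_norm _)).
- rewrite !ltr0_sg // -oppr_gt0 -sinN -mulrN pos // ?oppr_gt0 //.
  by rewrite (le_lt_trans (ler_norm _)) // normrN.
- by rewrite mulr0 sin0.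
Qed.

End exponential_bounds.

(** * Exponential moments determine the joint law *)
Section change_of_measure.
Context {R : realType} {d : measure_display} {Om : measurableType d}.
Variables (P0 P1 : {measure set Om -> \bar R}) (L : Om -> R).
Hypothesis mL : measurable_fun setT L.
Hypothesis L_ge0 : forall w, 0 <= L w.
Variables (n : nat) (X : 'I_n -> Om -> R).
Hypothesis mX : forall i, measurable_fun setT (X i).

Definition linear_form (v : 'I_n -> R) (w : Om) : R := \sum_(i < n) v i * X i w.

(** The test functions on which L dP0 and dP1 agree, integrability included. *)
Definition same_integral (f : Om -> R) : Prop :=
  [/\ measurable_fun setT f, P0.-integrable setT (EFin \o (fun w => f w * L w)),
      P1.-integrable setT (EFin \o f) &
      \int[P0]_w (f w * L w) = \int[P1]_w f w].

(** Agreement after multiplication by every exponential of a linear form.  This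
    strengthening is what makes limits possible: the dominating functions of
    multiplier_lim are exponentials of linear forms again. *)
Definition exp_stable (f : Om -> R) : Prop :=
  forall v, same_integral (fun w => f w * expR (linear_form v w)).

Definition multiplier (i : 'I_n) (g : R -> R) : Prop :=
  forall f, exp_stable f -> exp_stable (fun w => f w * g (X i w)).

Let ext (C : (Om -> R) -> Prop) f g : (forall w, f w = g w) -> C f -> C g.
Proof. by move=> /funext ->. Qed.

Lemma same_integralD f g : same_integral f -> same_integral g ->
  same_integral (fun w => f w + g w).
Proof.
move=> [mf f0 f1 fe] [mg g0 g1 ge]; split.
- exact: measurable_funD.
- have := integrableD measurableT f0 g0; congr (P0.-integrable _ _).
  by apply/funext => w /=; rewrite mulrDl.
- by have := integrableD measurableT f1 g1; congr (P1.-integrable _ _).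
- rewrite RintegralD // -fe -ge -RintegralD //.
  by apply: eq_Rintegral => w _; rewrite mulrDl.
Qed.

Lemma same_integralZ c f : same_integral f -> same_integral (fun w => c * f w).
Proof.
move=> [mf f0 f1 fe]; split.
- by apply: measurable_funM => //; exact: measurable_cst.
- have := integrableZl measurableT c f0; congr (P0.-integrable _ _).
  by apply/funext => w /=; rewrite -mulrA EFinM.
- by have := integrableZl measurableT c f1; congr (P1.-integrable _ _).
- rewrite RintegralZl // -fe -RintegralZl //.
  by apply: eq_Rintegral => w _; rewrite mulrA.
Qed.

Lemma same_integral_lim (f_ : (Om -> R)^nat) f h :
  (forall k, same_integral (f_ k)) ->
  P0.-integrable setT (EFin \o (fun w => h w * L w)) ->
  P1.-integrable setT (EFin \o h) ->
  (forall k w, `|f_ k w| <= h w) -> (forall w, f_ ^~ w @ \oo --> f w) ->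
  same_integral f.
Proof.
move=> sf h0 h1 fh ff.
have mf k : measurable_fun setT (f_ k) by case: (sf k).
have [i0 c0] : P0.-integrable setT (EFin \o (fun w => f w * L w)) /\
    \int[P0]_w (f_ k w * L w) @[k --> \oo] --> \int[P0]_w (f w * L w).
  apply: (Rintegral_dominated_cvg (f_ := fun k w => f_ k w * L w)
      (f := fun w => f w * L w) _ _ h0).
  - by move=> k; exact: measurable_funM.
  - by move=> w; apply: cvgM; [exact: ff|exact: cvg_cst].
  - by move=> k w; rewrite normrM (ger0_norm (L_ge0 w)) ler_wpM2r.
have [i1 c1] := Rintegral_dominated_cvg mf ff h1 fh.
split => //; first by apply: (measurable_fun_cvg mf) => w _; exact: ff.
have e : (fun k => \int[P0]_w (f_ k w * L w)) = (fun k => \int[P1]_w f_ k w).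
  by apply/funext => k; case: (sf k).
by move: c0; rewrite e => c0; exact: (cvg_unique _ c0 c1).
Qed.

Lemma exp_stableD f g : exp_stable f -> exp_stable g -> exp_stable (fun w => f w + g w).
Proof.
by move=> sf sg v; apply: ext (same_integralD (sf v) (sg v)) => w; rewrite mulrDl.
Qed.

Lemma exp_stableZ c f : exp_stable f -> exp_stable (fun w => c * f w).
Proof. by move=> sf v; apply: ext (same_integralZ c (sf v)) => w; rewrite mulrA. Qed.

Lemma multiplier_cst i c : multiplier i (cst c).
Proof. by move=> f sf; apply: ext (exp_stableZ c sf) => w /=; rewrite mulrC. Qed.

Lemma multiplierD i g h : multiplier i g -> multiplier i h ->
  multiplier i (fun x => g x + h x).
Proof.
by move=> sg sh f sf; apply: ext (exp_stableD (sg _ sf) (sh _ sf)) => w; rewrite mulrDr.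
Qed.

Lemma multiplierM i g h : multiplier i g -> multiplier i h ->
  multiplier i (fun x => g x * h x).
Proof. by move=> sg sh f sf; apply: ext (sh _ (sg _ sf)) => w; rewrite mulrA. Qed.

Lemma multiplierZ i c g : multiplier i g -> multiplier i (fun x => c * g x).
Proof. exact/multiplierM/multiplier_cst. Qed.

Lemma multiplierB i g h : multiplier i g -> multiplier i h ->
  multiplier i (fun x => g x - h x).
Proof.
move=> sg sh; have := multiplierD sg (multiplierZ (-1) sh).
by congr multiplier; apply/funext => x; rewrite mulN1r.
Qed.

Lemma multiplierX i g k : multiplier i g -> multiplier i (fun x => g x ^+ k).
Proof.
move=> sg; elim: k => [|k IH]; first exact: multiplier_cst.
have := multiplierM sg IH; congr multiplier.
by apply/funext => x; rewrite exprS.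
Qed.

Let lin0 w : linear_form (fun=> 0) w = 0.
Proof. by rewrite /linear_form big1 // => i _; rewrite mul0r. Qed.

Let lin_upd v (i : 'I_n) s w :
  linear_form (fun j => v j + s * (j == i)%:R) w = linear_form v w + s * X i w.
Proof.
rewrite /linear_form; under eq_bigr do rewrite mulrDl.
rewrite big_split /= (bigD1 i (P := xpredT) (F := fun j => s * (j == i)%:R * X j w)) //=.
rewrite eqxx mulr1 [X in _ + (_ + X)]big1 ?addr0 // => j /negbTE ->.
by rewrite mulr0 mul0r.
Qed.

Lemma multiplier_expR i s : multiplier i (fun x => expR (s * x)).
Proof.
move=> f sf v; apply: ext (sf (fun j => v j + s * (j == i)%:R)) => w.
by rewrite lin_upd expRD -mulrA [expR (s * _) * _]mulrC.
Qed.

(** Dominated convergence, with the factor exp (c X_i) + exp (- c X_i) absorbed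
    into the linear form of exp_stable. *)
Lemma multiplier_lim i (g_ : (R -> R)^nat) g (C c : R) :
  (forall k, multiplier i (g_ k)) ->
  (forall k x, `|g_ k x| <= C * (expR (c * x) + expR (- (c * x)))) ->
  (forall x, g_ ^~ x @ \oo --> g x) -> multiplier i g.
Proof.
move=> sg gC gg f sf v.
have C0 x : 0 <= C * (expR (c * x) + expR (- (c * x))) by apply: le_trans (gC 0%N x).
pose h w := C * `|f w * expR (linear_form (fun j => v j + c * (j == i)%:R) w)| +
            C * `|f w * expR (linear_form (fun j => v j + (- c) * (j == i)%:R) w)|.
have hE w : h w = `|f w| * expR (linear_form v w) * (C * (expR (c * X i w) + expR (- (c * X i w)))).
  rewrite /h !lin_upd !normrM !expRD !(ger0_norm (mulr_ge0 (expR_ge0 _) (expR_ge0 _))) mulNr.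
  by ring.
have s1 := sf (fun j => v j + c * (j == i)%:R).
have s2 := sf (fun j => v j + (- c) * (j == i)%:R).
apply: (same_integral_lim (f_ := fun k w => f w * g_ k (X i w) * expR (linear_form v w)) (h := h)).
- by move=> k; exact: sg.
- have [_ a1 _ _] := s1; have [_ a2 _ _] := s2.
  have := integrableD measurableT (integrableZl measurableT C (integrable_norm a1))
     (integrableZl measurableT C (integrable_norm a2)).
  congr (P0.-integrable _ _); apply/funext => w /=.
  by rewrite /h !normrM (ger0_norm (L_ge0 w)) -!EFinM -EFinD mulrDl -!mulrA.
- have [_ _ a1 _] := s1; have [_ _ a2 _] := s2.
  have := integrableD measurableT (integrableZl measurableT C (integrable_norm a1))
     (integrableZl measurableT C (integrable_norm a2)).
  by congr (P1.-integrable _ _).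
- move=> k w; rewrite hE !normrM (ger0_norm (expR_ge0 _)) mulrAC.
  by rewrite ler_wpM2l ?mulr_ge0 ?expR_ge0.
- move=> w; apply: cvgM; last exact: cvg_cst.
  by apply: cvgM; [exact: cvg_cst|exact: gg].
Qed.

Lemma multiplier_bounded_lim i (g_ : (R -> R)^nat) g :
  (forall k, multiplier i (g_ k)) -> (forall k x, `|g_ k x| <= 1) ->
  (forall x, g_ ^~ x @ \oo --> g x) -> multiplier i g.
Proof.
move=> sg g1; apply: (multiplier_lim (C := 1) (c := 0)) => // k x.
by rewrite mul0r oppr0 expR0 mul1r (le_trans (g1 k x)) //; lra.
Qed.

(** Difference quotients of exponentials at 0. *)
Lemma multiplier_id i : multiplier i id.
Proof.
apply: (@multiplier_lim i (fun k x => (expR (k.+1%:R^-1 * x) - 1) / k.+1%:R^-1) id 1 2).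
- move=> k; have := multiplierZ k.+1%:R (multiplierB (multiplier_expR i k.+1%:R^-1) (multiplier_cst i 1)).
  by congr multiplier; apply/funext => x; rewrite invrK mulrC.
- move=> k x; rewrite mul1r; apply: diff_quotient_expR_le.
  by rewrite invr_gt0 ltr0n /= invf_le1 ?ler1n.
- move=> x; apply: (@diff_quotient_expR_cvg _ (fun k => k.+1%:R^-1)); last exact: cvg_harmonic.
  by move=> k; rewrite invr_gt0 ltr0n /= invf_le1 ?ler1n.
Qed.

(** Taylor sums: polynomials in X_i are multipliers by multiplier_id. *)
Lemma multiplier_sin i (c a : R) : multiplier i (fun x => sin (c * (x - a))).
Proof.
apply: (@multiplier_lim i (fun k x => series (sin_coeff (c * (x - a))) k)
    _ (expR (`|c| * `|a|)) `|c|).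
- move=> k.
  have lin1 : multiplier i (fun x => c * (x - a)).
    exact: multiplierZ (multiplierB (multiplier_id i) (multiplier_cst i a)).
  rewrite /series /=; elim: k => [|k IH].
    have := multiplier_cst i 0; congr multiplier; apply/funext => x.
    by rewrite big_geq.
  have := multiplierD IH (multiplierZ ((odd k)%:R * (-1) ^+ k.-1./2 / k`!%:R) (multiplierX k lin1)).
  congr multiplier; apply/funext => x; rewrite big_nat_recr //=; congr (_ + _).
  by rewrite /sin_coeff /= mulrAC.
- move=> k x; apply: (le_trans (norm_series_sin_coeff_le _ _)).
  apply: (@le_trans _ _ (expR (`|c| * `|a|) * expR (Num.norm (`|c| * x)))); last first.
    by rewrite ler_wpM2l ?expR_ge0 // expR_norm_le.
  rewrite -expRD ler_expR !normrM normr_id -mulrDr ler_wpM2l // [leRHS]addrC.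
  exact: ler_normB.
- by move=> x; exact: cvg_series_sin_coeff.
Qed.

(** Two limits: iterates of the cubic applied to a sine give the sign of the
    sine, and dilating the sine gives the sign. *)
Lemma multiplier_sign i a : multiplier i (fun x => Num.sg (x - a)).
Proof.
have sg_le1 (y : R) : `|Num.sg y| <= 1 by rewrite normr_sg; case: eqP => _; rewrite ?lexx ?ler01.
apply: (@multiplier_bounded_lim i (fun k x => Num.sg (sin (k.+1%:R^-1 * (x - a))))) => //.
- move=> k; apply: (@multiplier_bounded_lim i (fun l x => iter l sign_step (sin (k.+1%:R^-1 * (x - a))))).
  + elim=> [|l IH]; first exact: multiplier_sin.
    have := multiplierZ 2^-1 (multiplierB (multiplierZ 3 IH) (multiplierX 3 IH)).
    by congr multiplier; apply/funext => x; rewrite /= /sign_step mulrC.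
  + by move=> l x; apply: sign_step_iter_le; exact: sin_max.
  + by move=> x; apply: sign_step_iter_cvg; exact: sin_max.
- by move=> x; exact: sign_sin_cvg.
Qed.

(** Half-lines are a generating pi-system, with indicator (sg^2 + sg) / 2. *)
Lemma multiplier_indic i (A : set (measurableTypeR R)) : measurable A -> multiplier i (\1_A).
Proof.
move=> mA; refine (@indic_dynkin R _ (measurableTypeR R) (multiplier i) (@RGenOInfty.G R) _ _ _ _ _ _ _ A mA).
- exact: RGenOInfty.measurableE.
- move=> _ _ [a ->] [b ->]; exists (Num.max a b); apply/seteqP; split => x /=.
    by rewrite !in_itv /= !andbT gt_max => -[-> ->].
  by rewrite !in_itv /= !andbT gt_max => /andP.
- exact: multiplier_cst.
- by move=> f g; exact: multiplierD.
- by move=> f g; exact: multiplierB.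
- by move=> f_ f; exact: multiplier_bounded_lim.
- move=> _ [a ->]; have := multiplierZ 2^-1 (multiplierD (multiplierX 2 (multiplier_sign i a)) (multiplier_sign i a)).
  congr multiplier; apply/funext => x.
  rewrite indicE; case: (boolP (x \in _)); rewrite ?inE ?notin_setE /= in_itv /= andbT.
    by move=> ax; rewrite gtr0_sg ?subr_gt0 // expr1n; field.
  move=> /negP; rewrite -leNgt le_eqVlt => /predU1P[->|xa].
    by rewrite subrr sgr0 expr0n addr0 mulr0.
  by rewrite ltr0_sg ?subr_lt0 // sqrrN expr1n subrr mulr0.
Qed.

Lemma same_integral_box (b : 'I_n -> set (measurableTypeR R)) :
  exp_stable (cst 1) -> (forall i, measurable (b i)) ->
  same_integral (fun w => \prod_(i < n) \1_(b i) (X i w)).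
Proof.
move=> s1 mb.
have H (s : seq 'I_n) : exp_stable (fun w => \prod_(i <- s) \1_(b i) (X i w)).
  elim: s => [|i s IH]; first by apply: ext s1 => w; rewrite big_nil.
  by refine (@ext exp_stable _ _ _ (multiplier_indic i (mb i) IH)) => w; rewrite big_cons mulrC.
refine (@ext same_integral _ _ _ (H (index_enum 'I_n) (fun=> 0))) => w; by rewrite lin0 expR0 mulr1.
Qed.

Let boxes := [set B : set (n.-tuple (measurableTypeR R)) |
  exists2 b : 'I_n -> set (measurableTypeR R),
    (forall i, measurable (b i)) & B = [set x | forall i, b i (tnth x i)]].

Let measurable_boxes : @measurable _ (n.-tuple (measurableTypeR R)) = <<s boxes >>.
Proof.
apply/seteqP; split.
  apply: smallest_sub; first exact: smallest_sigma_algebra.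
  rewrite -bigcup_seq => A [i _ [B mB <-]].
  apply: sub_sigma_algebra; exists (fun j => if j == i then B else setT).
    by move=> j; case: ifP.
  apply/seteqP; split => x /=; first by move=> [_ Bx] j; case: eqP => // ->.
  by move=> /(_ i); rewrite eqxx.
apply: smallest_sub; first exact: sigma_algebra_measurable.
move=> _ [b mb ->].
have -> : [set x | forall i, b i (tnth x i)] =
    \bigcap_(i in [set: 'I_n]) ((fun x : n.-tuple (measurableTypeR R) => tnth x i) @^-1` b i).
  by apply/seteqP; split => x /= h i; [move=> _; exact: h|exact: h].
apply: fin_bigcap_measurable; first exact: finite_finset.
by move=> i _; rewrite -[X in measurable X]setTI; exact: measurable_tnth.
Qed.

(** Finite exponential moments determine the joint law.  Boxes form a generating
    pi-system, and their indicators are products of multipliers applied to the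
    constant 1, the only function whose exponential moments are assumed. *)
Lemma same_integral_tuple (A : set (n.-tuple (measurableTypeR R))) :
  exp_stable (cst 1) -> measurable A ->
  same_integral (fun w => \1_A [tuple X i w | i < n]).
Proof.
move=> s1 mA.
pose Xt w : n.-tuple (measurableTypeR R) := [tuple X i w | i < n].
have mXt : measurable_fun setT Xt.
  by apply/measurable_fun_tnthP => i /=; apply: eq_measurable_fun (mX i) => w _;
    rewrite /Xt /= tnth_mktuple.
pose C (f : n.-tuple (measurableTypeR R) -> R) := same_integral (fun w => f (Xt w)).
have C1 : C (cst 1).
  refine (@ext same_integral _ _ _ (s1 (fun=> 0))) => w.
  by rewrite lin0 expR0 mulr1.
refine (@indic_dynkin R _ _ C boxes measurable_boxes _ C1 _ _ _ _ A mA).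
- move=> _ _ [a ma ->] [b mb ->]; exists (fun i => a i `&` b i).
    by move=> i; exact: measurableI.
  by apply/seteqP; split => x /=; [move=> [h1 h2] i; split|move=> h; split=> i; case: (h i)].
- by move=> f g; exact: same_integralD.
- move=> f g Cf Cg; have := same_integralD Cf (same_integralZ (-1) Cg).
  by apply: ext => w; rewrite mulN1r.
- move=> f_ f Cf f1 ff; have [_ a0 a1 _] := C1.
  by apply: (same_integral_lim (f_ := fun k w => f_ k (Xt w)) (h := cst 1)).
- move=> _ [b mb ->]; apply: (@ext same_integral _ _ _ (same_integral_box s1 mb)) => w.
  rewrite indicE; case: (boolP (_ \in _)) => [/set_mem /= h|/negP h].
    by rewrite big1 // => i _; rewrite indicE mem_set //; have := h i; rewrite tnth_mktuple.
  have [i bi] : exists i, ~ b i (X i w).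
    apply: contrapT => h'; apply: h; apply/mem_set => i /=; rewrite tnth_mktuple.
    by apply: contrapT => bi; apply: h'; exists i.
  by rewrite (bigD1 i) //= indicE memNset // mul0r.
Qed.

End change_of_measure.

(** * Gaussian samples *)
Section moments_from_mgf.
Context {R : realType} {d : measure_display} {T : measurableType d}.

Lemma Rintegral_fin (P : {measure set T -> \bar R}) (f : T -> R) (a : R) :
  (\int[P]_x (f x)%:E = a%:E)%E -> \int[P]_x f x = a.
Proof. by rewrite /Rintegral => ->. Qed.

Lemma ge0_integrable (P : {measure set T -> \bar R}) (f : T -> R) (a : R) :
  measurable_fun setT f -> (forall x, 0 <= f x) ->
  (\int[P]_x (f x)%:E = a%:E)%E -> P.-integrable setT (EFin \o f).
Proof.
move=> mf f0 fa; apply/integrableP; split; first exact/measurable_EFinP.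
under eq_integral do rewrite /= ger0_norm //.
by rewrite fa ltry.
Qed.

Lemma measurable_expR_comp (W : T -> R) (l : R) : measurable_fun setT W ->
  measurable_fun setT (fun x => expR (l * W x)).
Proof.
move=> mW; apply: (measurableT_comp (f := @expR R)).
  by apply: continuous_measurable_fun; exact: continuous_expR.
by apply: measurable_funM => //; exact: measurable_cst.
Qed.

(** The first two moments are read off the moment generating function by
    letting the step of difference quotients of x |-> expR (h x) tend to 0. *)
Lemma centered_gaussian_moments (P : probability T R) (W : T -> R) (s : R) :
  measurable_fun setT W ->
  (forall l, (\int[P]_x (expR (l * W x))%:E = (expR (l ^+ 2 * s ^+ 2 / 2))%:E)%E) ->
  [/\ P.-integrable setT (EFin \o W), \int[P]_x W x = 0,
      P.-integrable setT (EFin \o (fun x => W x ^+ 2)) & \int[P]_x (W x ^+ 2) = s ^+ 2].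
Proof.
move=> mW mgf.
have ei l : P.-integrable setT (EFin \o (fun x => expR (l * W x))).
  by apply: (ge0_integrable _ _ (mgf l)) => [|x]; [exact: measurable_expR_comp|exact: expR_ge0].
have eE l : \int[P]_x expR (l * W x) = expR (l ^+ 2 * s ^+ 2 / 2) by exact: Rintegral_fin.
have iD f1 f2 : P.-integrable setT (EFin \o f1) -> P.-integrable setT (EFin \o f2) ->
    P.-integrable setT (EFin \o (fun w => f1 w + f2 w)).
  by move=> h1 h2; have := integrableD measurableT h1 h2; congr (P.-integrable _ _).
have iZ c f1 : P.-integrable setT (EFin \o f1) ->
    P.-integrable setT (EFin \o (fun w => c * f1 w)).
  by move=> h1; have := integrableZl measurableT c h1; congr (P.-integrable _ _).
have ic c : P.-integrable setT (EFin \o (fun=> c)).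
  have /(iZ c) := ei 0; congr (P.-integrable _ _); apply/funext => x /=.
  by rewrite mul0r expR0 mulr1.
have Pc c : \int[P]_x c = c.
  by rewrite /Rintegral integral_cst //= probability_setT mule1.
pose h (k : nat) : R := k.+1%:R^-1.
have h01 k : 0 < h k <= 1 by rewrite invr_gt0 ltr0n /= invf_le1 ?ler1n.
have h0 k : 0 < h k by case/andP: (h01 k).
have hcvg : h @ \oo --> (0 : R) by exact: cvg_harmonic.
pose q k x := (expR (h k * W x) - 1) / h k.
have qcvg x : q ^~ x @ \oo --> W x by exact: diff_quotient_expR_cvg.
have mq k : measurable_fun setT (q k).
  apply: measurable_funM; last exact: measurable_cst.
  by apply: measurable_funB; [exact: measurable_expR_comp|exact: measurable_cst].
have hh0 : (fun k => h k ^+ 2) @ \oo --> (0 : R).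
  have -> : (fun k => h k ^+ 2) = (fun k => h k * h k) by apply/funext => k; rewrite expr2.
  by rewrite -[X in _ --> X](mulr0 0); exact: cvgM.
have h2cvg : (expR (h k ^+ 2 * (s ^+ 2 / 2)) - 1) / h k ^+ 2 @[k --> \oo] --> s ^+ 2 / 2.
  apply: (@diff_quotient_expR_cvg _ (fun k => h k ^+ 2)).
    by move=> k; rewrite exprn_gt0 //= exprn_ile1 ?(ltW (h0 k)) //; case/andP: (h01 k).
  exact: hh0.
have h2cvg' : (expR (h k ^+ 2 * (2 * s ^+ 2)) - 1) / h k ^+ 2 @[k --> \oo] --> 2 * s ^+ 2.
  apply: (@diff_quotient_expR_cvg _ (fun k => h k ^+ 2)).
    by move=> k; rewrite exprn_gt0 //= exprn_ile1 ?(ltW (h0 k)) //; case/andP: (h01 k).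
  exact: hh0.
have qle k x : `|q k x| <= expR (2 * W x) + expR (- 2 * W x).
  by rewrite mulNr; exact: diff_quotient_expR_le.
have q2le k x : `|q k x ^+ 2| <= 2 * expR (4 * W x) + 2 * expR (- 4 * W x).
  rewrite normrX (le_trans (lerXn2r 2 _ _ (qle k x))) ?nnegrE ?addr_ge0 ?expR_ge0 //.
  have -> : expR (4 * W x) = expR (2 * W x) ^+ 2 by rewrite expr2 -expRD; congr expR; ring.
  have -> : expR (- 4 * W x) = expR (- 2 * W x) ^+ 2 by rewrite expr2 -expRD; congr expR; ring.
  move: (expR _) (expR _) => a b; have := sqr_ge0 (a - b); rewrite sqrrB sqrrD; lra.
have [i1 c1] := Rintegral_dominated_cvg mq qcvg (iD _ _ (ei 2) (ei (- 2))) qle.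
have q2cvg x : (fun k => q k x ^+ 2) @ \oo --> W x ^+ 2.
  have -> : (fun k => q k x ^+ 2) = (fun k => q k x * q k x) by apply/funext => k; rewrite expr2.
  by rewrite expr2; apply: cvgM; exact: qcvg.
have [i2 c2] := Rintegral_dominated_cvg (f_ := fun k x => q k x ^+ 2) (f := fun x => W x ^+ 2)
  (fun k => measurable_funX 2 (mq k)) q2cvg (iD _ _ (iZ 2 _ (ei 4)) (iZ 2 _ (ei (- 4)))) q2le.
have E1 k : \int[P]_x q k x = h k * ((expR (h k ^+ 2 * (s ^+ 2 / 2)) - 1) / h k ^+ 2).
  transitivity (\int[P]_x ((h k)^-1 * expR (h k * W x) + - (h k)^-1)).
    by apply: eq_Rintegral => x _; rewrite /q; ring.
  rewrite RintegralD //; last exact: iZ.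
  rewrite RintegralZl // Pc eE.
  have -> : h k ^+ 2 * s ^+ 2 / 2 = h k ^+ 2 * (s ^+ 2 / 2) by rewrite mulrA.
  by move: (lt0r_neq0 (h0 k)) (expR _); move: (h k) => a a0 b; field.
have E2 k : \int[P]_x (q k x ^+ 2) = (expR (h k ^+ 2 * (2 * s ^+ 2)) - 1) / h k ^+ 2
    - 2 * ((expR (h k ^+ 2 * (s ^+ 2 / 2)) - 1) / h k ^+ 2).
  transitivity (\int[P]_x (((h k) ^- 2 * expR (2 * h k * W x) + - 2 * (h k) ^- 2 * expR (h k * W x))
     + (h k) ^- 2)).
    apply: eq_Rintegral => x _; rewrite /q.
    have -> : expR (2 * h k * W x) = expR (h k * W x) ^+ 2.
      by rewrite expr2 -expRD; congr expR; ring.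
    move: (lt0r_neq0 (h0 k)) (expR _); move: (h k) => a a0 b.
    by field.
  rewrite RintegralD //; last by apply: (iD); exact: iZ.
  rewrite RintegralD //; [|exact: iZ|exact: iZ].
  rewrite !RintegralZl // Pc !eE.
  have -> : (2 * h k) ^+ 2 * s ^+ 2 / 2 = h k ^+ 2 * (2 * s ^+ 2) by field.
  have -> : h k ^+ 2 * s ^+ 2 / 2 = h k ^+ 2 * (s ^+ 2 / 2) by rewrite mulrA.
  move: (lt0r_neq0 (h0 k)) (expR _) (expR _); move: (h k) => a a0 b c.
  by field.
split => //.
- have E1' : (fun k => \int[P]_x q k x) =
    (fun k => h k * ((expR (h k ^+ 2 * (s ^+ 2 / 2)) - 1) / h k ^+ 2)).
    by apply/funext => k; exact: E1.
  have c1' : (fun k => h k * ((expR (h k ^+ 2 * (s ^+ 2 / 2)) - 1) / h k ^+ 2)) @ \oo --> (0 : R).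
    by rewrite -[X in _ --> X](mul0r (s ^+ 2 / 2)); exact: cvgM hcvg h2cvg.
  by move: c1; rewrite E1' => c1; exact: (cvg_unique _ c1 c1').
- have E2' : (fun k => \int[P]_x (q k x ^+ 2)) = (fun k =>
    (expR (h k ^+ 2 * (2 * s ^+ 2)) - 1) / h k ^+ 2
    - 2 * ((expR (h k ^+ 2 * (s ^+ 2 / 2)) - 1) / h k ^+ 2)).
    by apply/funext => k; exact: E2.
  have c2' : (fun k => (expR (h k ^+ 2 * (2 * s ^+ 2)) - 1) / h k ^+ 2
    - 2 * ((expR (h k ^+ 2 * (s ^+ 2 / 2)) - 1) / h k ^+ 2)) @ \oo --> s ^+ 2.
    have e : 2 * s ^+ 2 - 2 * (s ^+ 2 / 2) = s ^+ 2 by field.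
    rewrite -[X in _ --> X]e.
    by apply: cvgB; [exact: h2cvg'|apply: cvgM; [exact: cvg_cst|exact: h2cvg]].
  by move: c2; rewrite E2' => c2; exact: (cvg_unique _ c2 c2').
Qed.

End moments_from_mgf.

Section gaussian_samples.
Context {R : realType} {d : measure_display} {Om : measurableType d}.
Variables (P : probability Om R) (G : R -> {mfun Om >-> measurableTypeR R}).
Variables (K : R -> R) (n : nat) (mean : 'I_n -> R).
Hypothesis gaussG : gaussian_process P G.
Hypothesis covG : has_covariance P G K.
Hypothesis meanG : has_mean P G mean.

Let x (i : 'I_n) : R := i.+1%:R / n%:R.
Let X (i : 'I_n) : Om -> R := G (x i).

Let x01 i : 0 <= x i <= 1.
Proof.
have n0 : (0 < n)%N by apply: leq_ltn_trans (ltn_ord i).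
by rewrite /x divr_ge0 //= ler_pdivrMr ?ltr0n // mul1r ler_nat.
Qed.

Let mX i : measurable_fun setT (X i).
Proof. by have := @measurable_funPT _ _ _ _ (G (x i)). Qed.

Let mlin v : measurable_fun setT (linear_form X v).
Proof.
apply: measurable_sum => i; apply: measurable_funM; [exact: measurable_cst|exact: mX].
Qed.

Let lin_law v : exists m s : R,
  [/\ forall l, (\int[P]_w (expR (l * linear_form X v w))%:E = (expR (l * m + l ^+ 2 * s ^+ 2 / 2))%:E)%E,
    P.-integrable setT (EFin \o linear_form X v), \int[P]_w linear_form X v w = m,
    P.-integrable setT (EFin \o (fun w => (linear_form X v w - m) ^+ 2)) &
    \int[P]_w ((linear_form X v w - m) ^+ 2) = s ^+ 2].
Proof.
have [m [s law]] := gaussG v x01; exists m, s.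
have mgf l : (\int[P]_w (expR (l * linear_form X v w))%:E = (expR (l * m + l ^+ 2 * s ^+ 2 / 2))%:E)%E.
  by apply: gaussian_law_mgf; [exact: mlin|exact: law].
have mW : measurable_fun setT (fun w => linear_form X v w - m).
  by apply: measurable_funB; [exact: mlin|exact: measurable_cst].
have [|i1 e1 i2 e2] := @centered_gaussian_moments _ _ _ P (fun w => linear_form X v w - m) s mW.
  move=> l; under eq_integral do rewrite mulrBr expRD EFinM muleC.
  rewrite ge0_integralZl //.
  - rewrite mgf -EFinM -expRD; congr (expR _)%:E; ring.
  - by apply/measurable_EFinP; exact: measurable_expR_comp.
have ic : P.-integrable setT (EFin \o (fun=> m)).
  exact: finite_measure_integrable_cst.
have il : P.-integrable setT (EFin \o linear_form X v).
  have := integrableD measurableT i1 ic; congr (P.-integrable _ _).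
  by apply/funext => w /=; rewrite -EFinD subrK.
split => //; transitivity (\int[P]_w ((linear_form X v w - m) + m)).
  by apply: eq_Rintegral => w _; rewrite subrK.
rewrite RintegralD // e1 add0r /Rintegral integral_cst //= probability_setT mule1 //.
Qed.

Let X_moments i : [/\ P.-integrable setT (EFin \o X i), \int[P]_w X i w = mean i &
  P.-integrable setT (EFin \o (fun w => (X i w - mean i) ^+ 2))].
Proof.
have [m [s [_ i1 e1 i2 _]]] := lin_law (fun j => (j == i)%:R).
have linE : linear_form X (fun j => (j == i)%:R) = X i.
  apply/funext => w; rewrite /linear_form (bigD1 i) //= eqxx mul1r big1 ?addr0 // => j /negbTE ->.
  by rewrite mul0r.
rewrite linE in i1 e1 i2.
have mE : m = mean i.
  have := meanG i; rewrite unlock => h; rewrite -e1; apply: Rintegral_fin; rewrite -h.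
  by apply: eq_integral => w _; rewrite /X tnth_mktuple.
by rewrite -mE.
Qed.

(** A linear form of the sample is Gaussian with some parameters m and s, which
    are identified with the mean and the variance of the form and then expanded
    by bilinearity. *)
Lemma gaussian_sample_mgf (v : 'I_n -> R) :
  (\int[P]_w (expR (linear_form X v w))%:E = (expR (\sum_(i < n) v i * mean i +
     (\sum_(i < n) \sum_(j < n) v i * v j * K (x i - x j)) / 2))%:E)%E.
Proof.
have [m [s [mgf _ e1 _ e2]]] := lin_law v.
have vX i : P.-integrable setT (EFin \o (fun w => v i * X i w)).
  have [h _ _] := X_moments i; have := integrableZl measurableT (v i) h.
  by congr (P.-integrable _ _).
have mE : m = \sum_(i < n) v i * mean i.
  rewrite -e1 /linear_form (Rintegral_sum measurableT vX).2; apply: eq_bigr => i _.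
  by have [h1 h2 _] := X_moments i; rewrite RintegralZl // h2.
pose Y i w := X i w - mean i.
have mY i : measurable_fun setT (Y i).
  by apply: measurable_funB; [exact: mX|exact: measurable_cst].
have YY i j : P.-integrable setT (EFin \o (fun w => Y i w * Y j w)).
  have [_ _ hi] := X_moments i; have [_ _ hj] := X_moments j.
  have := integrableD measurableT hi hj; apply: le_integrable => //.
    by apply/measurable_EFinP; exact: measurable_funM.
  move=> w _ /=; rewrite lee_fin [leRHS]ger0_norm ?addr_ge0 ?sqr_ge0 //.
  rewrite -/(Y i w) -/(Y j w) ler_norml; move: (Y i w) (Y j w) => a b.
  have := sqr_ge0 (a - b); have := sqr_ge0 (a + b); have := sqr_ge0 a; have := sqr_ge0 b.
  by rewrite sqrrB sqrrD => ? ? ? ?; apply/andP; split; lra.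
have EYY i j : \int[P]_w (Y i w * Y j w) = K (x i - x j).
  apply: Rintegral_fin; rewrite -(covG (x01 i) (x01 j)) !unlock.
  have E k : fine (\int[P]_w (G (x k) w)%:E) = mean k.
    by have [_ <- _] := X_moments k.
  by apply: eq_integral => w _; rewrite !E.
have vYY i j : P.-integrable setT (EFin \o (fun w => v i * v j * (Y i w * Y j w))).
  by have := integrableZl measurableT (v i * v j) (YY i j); congr (P.-integrable _ _).
have sE : s ^+ 2 = \sum_(i < n) \sum_(j < n) v i * v j * K (x i - x j).
  rewrite -e2.
  transitivity (\int[P]_w \sum_(i < n) \sum_(j < n) v i * v j * (Y i w * Y j w)).
    apply: eq_Rintegral => w _; rewrite mE /linear_form -sumrB expr2 mulr_suml.
    apply: eq_bigr => i _; rewrite mulr_sumr; apply: eq_bigr => j _.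
    by rewrite /Y; ring.
  have H i := Rintegral_sum measurableT (vYY i).
  rewrite (Rintegral_sum measurableT (fun i => (H i).1)).2; apply: eq_bigr => i _.
  by rewrite (H i).2; apply: eq_bigr => j _; rewrite RintegralZl // EYY.
have := mgf 1; rewrite mul1r expr1n mul1r sE mE => <-.
by apply: eq_integral => w _; rewrite mul1r.
Qed.

End gaussian_samples.

(** * Solvability from a quadratic bound *)
Section linear_algebra.
Context {R : realType}.

(** A vector in the kernel of S has a vanishing quadratic form, hence is
    orthogonal to z by the bound; so z lies in the range of the symmetric S. *)
Lemma solve_from_quadratic_bound (n : nat) (S : 'I_n -> 'I_n -> R) (z : 'I_n -> R) (c : R) :
  (forall i j, S i j = S j i) ->
  (forall u : 'I_n -> R, (\sum_(i < n) u i * z i) ^+ 2 <=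
     c * \sum_(i < n) \sum_(j < n) u i * u j * S i j) ->
  exists u : 'I_n -> R, forall i, \sum_(j < n) u j * S i j = z i.
Proof.
move=> Ssym Hq.
pose M : 'M[R]_n := \matrix_(i, j) S i j; pose Z : 'rV[R]_n := \row_i z i.
have /submxP[U ZU] : (Z <= M)%MS.
  rewrite submxE; apply/eqP/rowP => k; rewrite [RHS]mxE.
  have Mc i : \sum_(j < n) S i j * cokermx M j k = 0.
    by have /matrixP/(_ i k) := mulmx_coker M; rewrite !mxE; under eq_bigr do rewrite mxE.
  have := Hq (fun i => cokermx M i k).
  rewrite [X in c * X]big1 => [|i _]; last first.
    under eq_bigr => j _ do rewrite -mulrA [_ * S i j]mulrC.
    by rewrite -mulr_sumr Mc mulr0.
  rewrite mulr0 => h; have /eqP : (\sum_(i < n) cokermx M i k * z i) ^+ 2 = 0.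
    by apply/eqP; rewrite eq_le h sqr_ge0.
  rewrite sqrf_eq0 => /eqP <-; rewrite mxE; apply: eq_bigr => i _.
  by rewrite mxE mulrC.
exists (fun j => U 0 j) => i; have /rowP/(_ i) := ZU; rewrite !mxE => ->.
by apply: eq_bigr => j _; rewrite mxE Ssym.
Qed.

End linear_algebra.

(** * Testing error and Hellinger affinity *)
Section affinity.
Context {R : realType} {d : measure_display} {Om : measurableType d}.
Variable P : probability Om R.

(** M is the square root of a density, B the rejection event and rho the
    affinity.  For c > 0, integrating 2 M <= c + M^2 / c on B and
    2 M <= 1 / c + c M^2 off B gives 2 rho <= c m + (2 - m) / c, where m is the
    sum of the two errors; the best c gives rho^2 <= m (2 - m).  As m |-> m (2 - m) is
    increasing on [0, 1], m cannot be below dl. *)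
Lemma affinity_bound (M : Om -> R) (B : set Om) (rho dl : R) :
  measurable B -> (forall w, 0 < M w) ->
  P.-integrable setT (EFin \o M) -> \int[P]_w M w = rho ->
  P.-integrable setT (EFin \o (fun w => M w ^+ 2)) -> \int[P]_w (M w ^+ 2) = 1 ->
  0 < rho -> 0 < dl <= 1 -> dl * (2 - dl) <= rho ^+ 2 ->
  dl <= \int[P]_w (\1_B w) + \int[P]_w (\1_(~` B) w * M w ^+ 2).
Proof.
move=> mB M0 Mi Mrho M2i M21 rho0 /andP[d0 d1] drho.
have ind_i (A : set Om) : measurable A -> P.-integrable setT (EFin \o (\1_A : Om -> R)).
  by move=> mA; exact: integrable_indic.
have indM_i (A : set Om) : measurable A ->
    P.-integrable setT (EFin \o (fun w => \1_A w * M w ^+ 2)).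
  move=> mA; apply: (le_integrable measurableT _ _ M2i) => //.
    apply/measurable_EFinP; apply: measurable_funM; first exact: measurable_indic.
    by case/integrableP: M2i => /measurable_EFinP.
  move=> w _ /=; rewrite lee_fin normrM ler_piMl // indicE.
  by case: (_ \in _); rewrite ?normr1 ?normr0.
have mC := measurableC mB.
have indE w : \1_(~` B) w = 1 - \1_B w :> R.
  by rewrite !indicE in_setC; case: (w \in B); rewrite ?subrr ?subr0.
set al := \int[P]_w (\1_B w); set be := \int[P]_w (\1_(~` B) w * M w ^+ 2).
have al' : \int[P]_w (\1_(~` B) w) = 1 - al.
  under eq_Rintegral do rewrite indE.
  have i1 : P.-integrable setT (EFin \o (fun=> 1 : R)) by exact: finite_measure_integrable_cst.
  rewrite RintegralB //; last exact: ind_i.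
  by congr (_ - _); rewrite /Rintegral integral_cst //= probability_setT mule1.
have be' : \int[P]_w (\1_B w * M w ^+ 2) = 1 - be.
  rewrite -M21 /be -RintegralB //; last exact: indM_i.
  by apply: eq_Rintegral => w _; rewrite indE; ring.
rewrite leNgt; apply/negP => mlt; pose m := al + be.
have al0 : 0 <= al by apply: Rintegral_ge0 => w _; rewrite indicE.
have be0 : 0 <= be by apply: Rintegral_ge0 => w _; rewrite mulr_ge0 ?sqr_ge0 // indicE.
have m0 : 0 <= m by rewrite addr_ge0.
have m1 : m < 1 by exact: lt_le_trans mlt d1.
have key c : 0 < c -> 2 * rho <= c * m + c^-1 * (2 - m).
  move=> c0; have -> : c * m + c^-1 * (2 - m) =
      (c * al + c * be) + (c^-1 * (1 - be) + c^-1 * (1 - al)) by rewrite /m; ring.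
  have iZ k f : P.-integrable setT (EFin \o f) -> P.-integrable setT (EFin \o (fun w : Om => k * f w)).
    by move=> h; have := integrableZl measurableT k h; congr (P.-integrable _ _).
  have iD f1 f2 : P.-integrable setT (EFin \o f1) -> P.-integrable setT (EFin \o f2) ->
      P.-integrable setT (EFin \o (fun w : Om => f1 w + f2 w)).
    by move=> h1 h2; have := integrableD measurableT h1 h2; congr (P.-integrable _ _).
  have j1 := iZ c _ (ind_i _ mB); have j2 := iZ c _ (indM_i _ mC).
  have j3 := iZ c^-1 _ (indM_i _ mB); have j4 := iZ c^-1 _ (ind_i _ mC).
  rewrite -Mrho -RintegralZl // -be' -al' /al /be.
  rewrite -(RintegralZl _ _ (ind_i _ mB)) // -(RintegralZl _ _ (indM_i _ mC)) //.
  rewrite -(RintegralZl _ _ (indM_i _ mB)) // -(RintegralZl _ _ (ind_i _ mC)) //.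
  rewrite -RintegralD // -RintegralD //.
  have j12 := iD _ _ j1 j2; have j34 := iD _ _ j3 j4.
  rewrite -RintegralD //.
  apply: le_Rintegral => //; [exact: iZ|exact: iD|].
  move=> w _; rewrite indE.
  have tw (a : R) : 0 < a -> 2 * M w <= a + a^-1 * M w ^+ 2.
    move=> a0; have : 0 <= a^-1 * (a - M w) ^+ 2.
      by rewrite mulr_ge0 ?sqr_ge0 // invr_ge0 ltW.
    rewrite sqrrB !mulrDr; have -> : a^-1 * a ^+ 2 = a by field; rewrite lt0r_neq0.
    have -> : a^-1 * - (a * M w *+ 2) = - (2 * M w).
      by rewrite -mulr_natr; field; rewrite lt0r_neq0.
    lra.
  rewrite !indicE; case: (w \in B) => /=.
    by rewrite subrr !(mul1r, mul0r, mulr1, mulr0, addr0); exact: tw.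
  rewrite subr0 !(mul1r, mul0r, mulr1, mulr0, addr0, add0r).
  have := tw c^-1; rewrite invrK invr_gt0 => /(_ c0); lra.
(* for m = 0 the best c is infinite; c = 2 / rho already gives a contradiction *)
move: m0; rewrite le_eqVlt => /predU1P[mE|m_gt0].
  have c0 : 0 < 2 / rho by rewrite divr_gt0.
  have := key _ c0; rewrite -mE mulr0 add0r subr0 invf_div divfK ?pnatr_eq0 //; lra.
pose c := Num.sqrt ((2 - m) / m).
have q0 : 0 < (2 - m) / m by rewrite divr_gt0 //; lra.
have c0 : 0 < c by rewrite sqrtr_gt0.
have c2 : c ^+ 2 = (2 - m) / m by rewrite sqr_sqrtr // ltW.
have h1 : rho <= c * m.
  have := key c c0; have -> : c^-1 * (2 - m) = c * m; last lra.
  have -> : 2 - m = c ^+ 2 * m by rewrite c2; field; rewrite lt0r_neq0.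
  by field; rewrite lt0r_neq0.
have h2 : rho ^+ 2 <= m * (2 - m).
  apply: (@le_trans _ _ ((c * m) ^+ 2)); first by rewrite lerXn2r ?nnegrE ?mulr_ge0 // ltW.
  by rewrite exprMn c2 le_eqVlt; apply/orP; left; apply/eqP; field; rewrite lt0r_neq0.
have : 0 < (dl - m) * (2 - dl - m) by rewrite mulr_gt0 // ?subr_gt0 //; lra.
by move: h2 drho; move: (rho ^+ 2) => r2; rewrite -/m; lra.
Qed.

End affinity.

(** * Lower bound for two Gaussian hypotheses *)
Section two_point.
Context {R : realType} {d : measure_display} {Om : measurableType d}.

(** The density is L = exp (u . X - D / 2).  Since S u = mean, completing the
    square in the Gaussian exponents shows that L dP0 and dP1 have the same
    exponential moments, so they induce the same law of the sample, and the
    affinity is E [sqrt L] = exp (D / 8 - D / 4). *)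
Lemma two_point_bound (K : R -> R) (n : nat) (G : R -> {mfun Om >-> measurableTypeR R})
    (P0 P1 : probability Om R) (mean u : 'I_n -> R) (dl : R)
    (A : set (n.-tuple (measurableTypeR R))) :
  let S i j := K (i.+1%:R / n%:R - j.+1%:R / n%:R) in
  (forall t, K (- t) = K t) ->
  gaussian_process P0 G -> has_covariance P0 G K -> has_mean P0 G (fun _ : 'I_n => 0) ->
  gaussian_process P1 G -> has_covariance P1 G K -> has_mean P1 G mean ->
  (forall i : 'I_n, \sum_(j < n) u j * S i j = mean i) ->
  measurable A -> 0 < dl <= 1 ->
  dl * (2 - dl) <= expR (- (\sum_(i < n) u i * mean i) / 4) ->
  dl <= fine (P0 (observation n G @^-1` A)) + fine (P1 (observation n G @^-1` (~` A))).
Proof.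
move=> S Keven g0 c0 m0 g1 c1 m1 uS mA dl01 hdl.
set D := \sum_(i < n) u i * mean i in hdl *.
pose X (i : 'I_n) : Om -> R := G (i.+1%:R / n%:R).
have mX i : measurable_fun setT (X i) by have := @measurable_funPT _ _ _ _ (G (i.+1%:R / n%:R)).
have mlin v : measurable_fun setT (linear_form X v).
  by apply: measurable_sum => i; apply: measurable_funM; [exact: measurable_cst|exact: mX].
pose q (v : 'I_n -> R) := \sum_(i < n) \sum_(j < n) v i * v j * S i j.
have mgf0 v : (\int[P0]_w (expR (linear_form X v w))%:E = (expR (q v / 2))%:E)%E.
  have := gaussian_sample_mgf g0 c0 m0 v; rewrite [X in expR (X + _)]big1 ?add0r //.
  by move=> i _; rewrite mulr0.
have mgf1 v := gaussian_sample_mgf g1 c1 m1 v.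
have mexp v : measurable_fun setT (fun w => expR (linear_form X v w)).
  have := measurable_expR_comp 1 (mlin v).
  by apply: eq_measurable_fun => w _; rewrite mul1r.
have i0 v : P0.-integrable setT (EFin \o (fun w => expR (linear_form X v w))).
  by apply: (ge0_integrable (mexp v) _ (mgf0 v)) => w; exact: expR_ge0.
have i1 v : P1.-integrable setT (EFin \o (fun w => expR (linear_form X v w))).
  by apply: (ge0_integrable (mexp v) _ (mgf1 v)) => w; exact: expR_ge0.
have linD v v' w : linear_form X (fun i => v i + v' i) w = linear_form X v w + linear_form X v' w.
  by rewrite /linear_form -big_split; apply: eq_bigr => i _; rewrite mulrDl.
have linZ k v w : linear_form X (fun i => k * v i) w = k * linear_form X v w.
  by rewrite /linear_form mulr_sumr; apply: eq_bigr => i _; rewrite mulrA.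
have qu v : \sum_(i < n) \sum_(j < n) v i * u j * S i j = \sum_(i < n) v i * mean i.
  apply: eq_bigr => i _; rewrite -uS mulr_sumr; apply: eq_bigr => j _; ring.
have qE : q u = D by exact: qu.
have Ssym i j : S i j = S j i by rewrite /S -Keven opprB.
have qD v : q (fun i => u i + v i) = D + 2 * (\sum_(i < n) v i * mean i) + q v.
  rewrite -qE -qu /q mulr_sumr.
  have -> : \sum_(i < n) \sum_(j < n) (u i + v i) * (u j + v j) * S i j =
    \sum_(i < n) \sum_(j < n) u i * u j * S i j + \sum_(i < n) \sum_(j < n) v i * u j * S i j +
    \sum_(i < n) \sum_(j < n) v j * u i * S j i + \sum_(i < n) \sum_(j < n) v i * v j * S i j.
    rewrite -!big_split /=; apply: eq_bigr => i _; rewrite -!big_split /=.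
    by apply: eq_bigr => j _; rewrite (Ssym j i); ring.
  rewrite [X in _ + _ + X + _]exchange_big /=; congr (_ + _); rewrite -addrA; congr (_ + _).
  by rewrite -big_split; apply: eq_bigr => i _ /=; ring.
(* the square root of the density *)
pose M w := expR (linear_form X (fun i => 2^-1 * u i) w) * expR (- D / 4).
pose L w := M w ^+ 2.
have LE w : L w = expR (linear_form X u w) * expR (- D / 2).
  by rewrite /L /M exprMn linZ !expr2 -!expRD; congr expR; lra.
have stable : exp_stable P0 P1 L X (cst 1).
  move=> v.
  have E0 : forall w, cst 1 w * expR (linear_form X v w) * L w =
      expR (- D / 2) * expR (linear_form X (fun i => u i + v i) w).
    by move=> w; rewrite LE linD expRD /=; ring.
  have j0 := integrableZl measurableT (expR (- D / 2)) (i0 (fun i => u i + v i)).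
  have E1 : forall w, cst 1 w * expR (linear_form X v w) = expR (linear_form X v w) by move=> w; rewrite /= mul1r.
  split.
  - by apply: eq_measurable_fun (mexp v) => w _; rewrite E1.
  - move: j0; congr (P0.-integrable _ _); apply/funext => w.
    by rewrite -[RHS]/((cst 1 w * expR (linear_form X v w) * L w)%:E) E0 EFinM.
  - by move: (i1 v); congr (P1.-integrable _ _); apply/funext => w /=; rewrite mul1r.
  - under eq_Rintegral do rewrite E0.
    under [RHS]eq_Rintegral do rewrite E1.
    rewrite RintegralZl // (Rintegral_fin (mgf0 _)) (Rintegral_fin (mgf1 _)) qD -expRD.
    by congr expR; rewrite -/(q v); field.
have mL : measurable_fun setT L.
  have := measurable_funM (mexp u) (measurable_cst (expR (- D / 2))).
  by apply: eq_measurable_fun => w _; rewrite LE.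
have L0 w : 0 <= L w by exact: sqr_ge0.
have obsE w : observation n G w = [tuple X i w | i < n] by [].
have mobs : measurable_fun setT (observation n G).
  by apply/measurable_fun_tnthP => i /=; apply: eq_measurable_fun (mX i) => w _;
    rewrite /= tnth_mktuple.
have mB (A' : set (n.-tuple (measurableTypeR R))) : measurable A' ->
    measurable (observation n G @^-1` A').
  by move=> mA'; rewrite -[X in measurable X]setTI; exact: mobs.
have [_ _ _ chg] := same_integral_tuple mL L0 mX stable (measurableC mA).
have fineP (P : probability Om R) (B : set Om) : measurable B ->
    fine (P B) = \int[P]_w \1_B w.
  by move=> mB'; rewrite /Rintegral integral_indic // setIT.
rewrite !fineP; [|exact/mB/measurableC|exact: mB].
have -> : \int[P1]_w \1_(observation n G @^-1` (~` A)) w =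
    \int[P0]_w (\1_(~` (observation n G @^-1` A)) w * M w ^+ 2).
  have -> : \int[P1]_w \1_(observation n G @^-1` (~` A)) w =
      \int[P1]_w \1_(~` A) [tuple X i w | i < n] by [].
  by rewrite -chg; apply: eq_Rintegral.
have rhoE : \int[P0]_w M w = expR (- D / 8).
  rewrite /M RintegralZr // (Rintegral_fin (mgf0 _)) -expRD; congr expR.
  have -> : q (fun i => 2^-1 * u i) = 4^-1 * D.
    rewrite -qE /q mulr_sumr; apply: eq_bigr => i _; rewrite mulr_sumr.
    by apply: eq_bigr => j _; field.
  by field.
have [_ Li _ Le] := stable (fun=> 0).
have lin0 w : linear_form X (fun=> 0) w = 0 by rewrite /linear_form big1 // => i _; rewrite mul0r.
apply: (affinity_bound _ _ _ rhoE) => //.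
- exact: mB.
- by move=> w; rewrite /M mulr_gt0 ?expR_gt0.
- have := integrableZr measurableT (expR (- D / 4)) (i0 (fun i => 2^-1 * u i)).
  by congr (P0.-integrable _ _).
- move: Li; congr (P0.-integrable _ _); apply/funext => w /=.
  by rewrite lin0 expR0 !mul1r.
- move: Le; under eq_Rintegral do rewrite lin0 expR0 /= !mul1r.
  move=> ->; under eq_Rintegral do rewrite lin0 expR0 /= !mul1r.
  by rewrite /Rintegral integral_cst //= probability_setT mule1.
- exact: expR_gt0.
- rewrite expr2 -expRD; apply: (le_trans hdl); rewrite ler_expR; lra.
Qed.

End two_point.

(** * Lower bound for the detection of a shift in mean *)
Theorem theorem6p1 (R : realType) (K : R -> R) (p : nat) (beta C'K : R)
    (K_cov : covariance_function K)
    (K_int : lebesgue_measure.-integrable setT (EFin \o K))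
    (p_gt0 : (0 < p)%N) (beta_gt : 2^-1 < beta)
    (C'K_gt0 : 0 < C'K)
    (K_lim : spectral_density K w * `|w| ^+ (2 * p) @[w --> +oo] --> C'K)
    (K_limsup :
      (limf_esup
        (fun w : R => (`| (spectral_density K w * `|w| ^+ (2 * p) / C'K - 1)
                          * w `^ beta |)%:E)
        (+oo_ R) < +oo)%E) :
  exists (CK : R) (n0 : nat),
    [/\ 0 < CK, (0 < n0)%N &
    forall (alpha delta b : R) (n : nat)
      (d : measure_display) (Om : measurableType d)
      (G : R -> {mfun Om >-> measurableTypeR R})
      (P0 : probability Om R) (P1 : nat -> probability Om R)
      (T : {mfun n.-tuple (measurableTypeR R) >-> bool}),
      0 < alpha < 2^-1 ->
      0 < delta <= 1 ->
      (n0 <= n)%N ->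
      (exists t, t \in change_points alpha n) ->
      b != 0 ->
      `|b| <= CK * n%:R `^ (2^-1 - p%:R)
              * Num.sqrt (ln (1 / (delta * (2 - delta)))) ->
      null_hypothesis n K G P0 ->
      (forall t, t \in change_points alpha n ->
         alternative_hypothesis n K b t G (P1 t)) ->
      delta <= test_error alpha G P0 P1 T].
Proof.
have [C [n0 [C0 n00 HC]]] := step_detection_bound K_cov K_int p_gt0 C'K_gt0 K_lim.
(* with this constant, b^2 C n^(2p - 1) / 4 <= 4 log (1 / (delta (2 - delta))) *)
exists (4 / Num.sqrt C), n0; split => //; first by rewrite divr_gt0 // sqrtr_gt0.
move=> alpha delta b n d Om G P0 P1 T _ dl01 nn0 [t ta] b0 hb [g0 c0 m0] H1.
have [g1 c1 m1] := H1 t ta.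
have n_gt0 : (0 < n)%N by exact: leq_trans nn0.
have tn : (0 < t <= n)%N by move: ta; rewrite inE => /andP[].
pose S (i j : 'I_n) := K (i.+1%:R / n%:R - j.+1%:R / n%:R).
have Ssym i j : S i j = S j i by rewrite /S -(proj1 K_cov) opprB.
have Hn u := HC n t u nn0 tn.
have [u0 Hu0] := solve_from_quadratic_bound Ssym Hn.
pose u i := b / 2 * u0 i.
have Hu i : \sum_(j < n) u j * S i j = b / 2 * zeta t i.
  by rewrite -Hu0 mulr_sumr; apply: eq_bigr => j _; rewrite mulrA.
pose D := \sum_(i < n) u i * (b / 2 * zeta t i).
have DE : D = \sum_(i < n) \sum_(j < n) u i * u j * S i j.
  by apply: eq_bigr => i _; rewrite -Hu mulr_sumr; apply: eq_bigr => j _; rewrite mulrA.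
have D0 : 0 <= D by rewrite DE; exact: (proj2 K_cov).
have D2 : D ^+ 2 <= (b / 2) ^+ 2 * (C * n%:R ^+ (2 * p).-1 * D).
  have e : D = b / 2 * \sum_(i < n) u i * zeta t i.
    by rewrite mulr_sumr; apply: eq_bigr => i _; ring.
  by rewrite {1}e exprMn ler_wpM2l ?sqr_ge0 // DE; exact: Hn.
pose N : R := n%:R ^+ (2 * p).-1; have N0 : 0 < N by rewrite exprn_gt0 // ltr0n.
have D_le : D <= (b / 2) ^+ 2 * (C * N).
  move: D0; rewrite le_eqVlt => /predU1P[<-|D_gt0].
    by rewrite mulr_ge0 ?sqr_ge0 // mulr_ge0 // ltW.
  by rewrite -(ler_pM2r D_gt0) -mulrA; exact: D2.
have {}dl01' := dl01; case/andP: dl01' => dl0 dl1.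
have dd0 : 0 < delta * (2 - delta) by rewrite mulr_gt0 //; lra.
pose Lg := ln (1 / (delta * (2 - delta))).
have LgE : expR (- Lg) = delta * (2 - delta).
  by rewrite /Lg mul1r lnV ?posrE // opprK lnK ?posrE.
have Lg0 : 0 <= Lg.
  rewrite -oppr_le0 -ler_expR LgE expR0.
  by have := sqr_ge0 (1 - delta); rewrite sqrrB expr1n; lra.
pose r : R := n%:R `^ (2^-1 - p%:R).
have NrE : N * r ^+ 2 = 1.
  have n_ge0 : 0 <= n%:R :> R by [].
  have n_neq0 : n%:R != 0 :> R by rewrite pnatr_eq0 -lt0n.
  rewrite /N /r -powR_mulrn // -powR_mulrn ?powR_ge0 // -powRrM -powRD; last first.
    by rewrite n_neq0 implybT.
  have -> : ((2 * p).-1)%:R = 2 * p%:R - 1 :> R.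
    by rewrite -subn1 natrB ?muln_gt0 // natrM.
  have -> : 2 * p%:R - 1 + (2^-1 - p%:R) * 2%:R = 0 :> R by field.
  by rewrite powRr0.
have b2 : b ^+ 2 <= 16 / C * r ^+ 2 * Lg.
  rewrite -real_normK ?num_real //.
  apply: (@le_trans _ _ ((4 / Num.sqrt C * r * Num.sqrt Lg) ^+ 2)).
    by apply: lerXn2r; rewrite ?nnegrE // !mulr_ge0 ?powR_ge0 ?sqrtr_ge0 // invr_ge0 sqrtr_ge0.
  rewrite !exprMn exprVn !sqr_sqrtr // ?(ltW C0) //.
  by have -> : (4 : R) ^+ 2 = 16 by ring.
have D4 : D <= 4 * Lg.
  apply: (le_trans D_le).
  have -> : (b / 2) ^+ 2 * (C * N) = b ^+ 2 * (C * N / 4) by field.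
  apply: (@le_trans _ _ (16 / C * r ^+ 2 * Lg * (C * N / 4))).
    by rewrite ler_wpM2r // !mulr_ge0 // ltW.
  have -> : 16 / C * r ^+ 2 * Lg * (C * N / 4) = 4 * Lg * (N * r ^+ 2).
    by field; rewrite lt0r_neq0.
  by rewrite NrE mulr1.
have mT : measurable (T @^-1` [set true]) by exact: measurable_funPTI.
have := two_point_bound (proj1 K_cov) g0 c0 m0 g1 c1 m1 Hu mT dl01.
move=> /(_ _)/le_trans; apply.
  by rewrite -LgE ler_expR -/D; lra.
rewrite /test_error; apply: lerD.
  by rewrite le_eqVlt; apply/orP; left; apply/eqP.
have -> : observation n G @^-1` (~` (T @^-1` [set true])) =
    [set w | T (observation n G w) = false].
  by apply/seteqP; split => w /=; case: (T _).
by apply: (le_bigmax_seq _ t) => //; rewrite mem_index_iota ltnS.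
Qed.
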